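(* Let $p$ be a prime and let $K/\mathbf{Q}_p$ be a finite extension of degree $n$ and ramification index $e$, with ring of integers $\mathcal{O}_K$ and maximal ideal $\mathfrak{m}_K$. Let $E/K$ be an elliptic curve given by a Weierstrass equation over $\mathcal{O}_K$ of the form $$Y^2 + a_1 XY + a_3 Y = X^3 + a_2 X^2 + a_4 X + a_6,\qquad a_i\in\mathfrak{m}_K \text{ for each } i$$ (so that it has additive reduction). If $6e<p-1$, then $E_0(K)\cong \mathbf{Z}_p^n$ as $\mathbf{Z}_p$-modules.
   Context: $E_0(K)\subset E(K)$ is the subgroup of points whose reduction modulo $\mathfrak{m}_K$ (with respect to the given Weierstrass equation) is a non-singular point of the reduced curve over the residue field. The group $E_0(K)$ carries a $\mathbf{Z}_p$-module structure extending its $\mathbf{Z}$-module structure (for $a\in\mathbf{Z}_p$ and integers $m_j\to a$ $p$-adically, $aP=\lim_j m_jP$ in the $p$-adic topology of $E(K)$). *)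

(* Defs.v *)
From HB Require Import structures.
From mathcomp Require Import all_boot all_order all_algebra all_field.
From mathcomp Require Import boolp.

Set Implicit Arguments.
Unset Strict Implicit.
Unset Printing Implicit Defensive.

Import GRing.Theory.
Local Open Scope ring_scope.

(* Z_p = lim Z/p^k: [pval x k] is the representative of x mod p^k in         *)
(* [0, p^k). Primality only serves to make the ring an integral domain.      *)
Record padic_int (p : nat) (hp : prime p) := PadicInt {
  pval : nat -> int;
  pvalP : forall k, pval k = (pval k.+1 %% (p ^ k)%N)%Z
}.

Section PadicIntRing.
Variables (p : nat) (hp : prime p).
Local Notation Zp := (padic_int hp).
Local Notation q k := (Posz (p ^ k)%N).

Lemma padic_ext (x y : Zp) : pval x =1 pval y -> x = y.
Proof.
case: x y => [f hf] [g hg] /= /funext fg; rewrite fg in hf *.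
by congr PadicInt; exact: Prop_irrelevance.
Qed.

HB.instance Definition _ := gen_eqMixin Zp.
HB.instance Definition _ := gen_choiceMixin Zp.

Lemma pval_mod (x : Zp) k : (pval x k %% q k)%Z = pval x k.
Proof. by rewrite [in LHS]pvalP modz_mod -pvalP. Qed.

Lemma modz_modq (a : int) k : ((a %% q k.+1)%Z = a %[mod q k])%Z.
Proof.
apply/eqP; rewrite eqz_mod_dvd; apply/dvdzP.
exists (- (a %/ q k.+1)%Z * p%:Z).
rewrite {2}(divz_eq a (q k.+1)) opprD addrCA subrr addr0.
by rewrite expnS PoszM mulrA !mulNr.
Qed.

Lemma padic_of_subproof (f : nat -> int) :
  (forall k, (f k.+1 = f k %[mod q k])%Z) ->
  forall k, (f k %% q k = (f k.+1 %% q k.+1)%Z %% q k)%Z.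
Proof. by move=> hf k; rewrite modz_modq hf. Qed.

Definition padic_of f hf : Zp := PadicInt hp (padic_of_subproof (f := f) hf).

Lemma pval_next (x : Zp) k : (pval x k.+1 = pval x k %[mod q k])%Z.
Proof. by rewrite -pvalP pval_mod. Qed.

Lemma padic_cst_subproof (c : int) (k : nat) : (c = c %[mod q k])%Z.
Proof. by []. Qed.
Lemma padic_opp_subproof (x : Zp) k :
  (- pval x k.+1 = - pval x k %[mod q k])%Z.
Proof. by rewrite -modzNm pval_next modzNm. Qed.
Lemma padic_add_subproof (x y : Zp) k :
  (pval x k.+1 + pval y k.+1 = pval x k + pval y k %[mod q k])%Z.
Proof. by rewrite -modzDm !pval_next modzDm. Qed.
Lemma padic_mul_subproof (x y : Zp) k :
  (pval x k.+1 * pval y k.+1 = pval x k * pval y k %[mod q k])%Z.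
Proof. by rewrite -modzMm !pval_next modzMm. Qed.

Definition padic_cst (c : int) := padic_of (padic_cst_subproof c).
Definition padic_opp x := padic_of (padic_opp_subproof x).
Definition padic_add x y := padic_of (padic_add_subproof x y).
Definition padic_mul x y := padic_of (padic_mul_subproof x y).

Lemma padic_addA : associative padic_add.
Proof. by move=> x y z; apply: padic_ext => k /=; rewrite modzDmr modzDml addrA. Qed.
Lemma padic_addC : commutative padic_add.
Proof. by move=> x y; apply: padic_ext => k /=; rewrite addrC. Qed.
Lemma padic_add0 : left_id (padic_cst 0) padic_add.
Proof. by move=> x; apply: padic_ext => k /=; rewrite modzDml add0r pval_mod. Qed.
Lemma padic_addN : left_inverse (padic_cst 0) padic_opp padic_add.
Proof. by move=> x; apply: padic_ext => k /=; rewrite modzDml addNr. Qed.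

HB.instance Definition _ := GRing.isZmodule.Build Zp
  padic_addA padic_addC padic_add0 padic_addN.

Lemma padic_mulA : associative padic_mul.
Proof. by move=> x y z; apply: padic_ext => k /=; rewrite modzMmr modzMml mulrA. Qed.
Lemma padic_mulC : commutative padic_mul.
Proof. by move=> x y; apply: padic_ext => k /=; rewrite mulrC. Qed.
Lemma padic_mul1 : left_id (padic_cst 1) padic_mul.
Proof. by move=> x; apply: padic_ext => k /=; rewrite modzMml mul1r pval_mod. Qed.
Lemma padic_mulDl : left_distributive padic_mul padic_add.
Proof.
by move=> x y z; apply: padic_ext => k /=; rewrite modzMml mulrDl modzDm.
Qed.
Lemma padic_1neq0 : padic_cst 1 != 0.
Proof.
apply/eqP => /(congr1 (fun x => pval x 1)) /=; rewrite expn1 mod0z modz_small //.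
by rewrite ltz_nat prime_gt1.
Qed.

HB.instance Definition _ := GRing.Zmodule_isComNzRing.Build Zp
  padic_mulA padic_mulC padic_mul1 padic_mulDl padic_1neq0.

Definition padic_unit : {pred Zp} := fun x => `[< exists y : Zp, y * x = 1 >].
Definition padic_inv (x : Zp) : Zp :=
  if pselect (exists y : Zp, y * x = 1) is left h then projT1 (cid h) else x.

Lemma padic_mulVx : {in padic_unit, left_inverse 1 padic_inv *%R}.
Proof.
move=> x /asboolP hx; rewrite /padic_inv; case: pselect => // h.
exact: (projT2 (cid h)).
Qed.
Lemma padic_unitPl (x y : Zp) : y * x = 1 -> padic_unit x.
Proof. by move=> yx; apply/asboolP; exists y. Qed.
Lemma padic_inv_out : {in [predC padic_unit], padic_inv =1 id}.
Proof.
by move=> x /asboolPn hx; rewrite /padic_inv; case: pselect.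
Qed.

HB.instance Definition _ := GRing.ComNzRing_hasMulInverse.Build Zp
  padic_mulVx padic_unitPl padic_inv_out.

Lemma pval_eq0_le (x : Zp) j k :
  (j <= k)%N -> (pval x j == 0) = (q j %| pval x k)%Z.
Proof.
move=> /subnK <-; elim: (k - j)%N => [|i IH].
  by rewrite add0n (sameP dvdz_mod0P eqP) pval_mod.
rewrite IH addSn pvalP; set a := pval x _.
rewrite [in RHS](divz_eq a (q (i + j))) [RHS]rpredDl //.
by apply: dvdz_mull; rewrite dvdzE /= dvdn_exp2l ?leq_addl.
Qed.

Lemma padic_integral (x y : Zp) : x * y = 0 -> (x == 0) || (y == 0).
Proof.
move=> xy0; apply: contrapT => /negP; rewrite negb_or => /andP[/eqP x0 /eqP y0].
have nz (z : Zp) : z <> 0 -> exists k, pval z k != 0.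
  move=> z0; apply: contrapT => h; apply: z0; apply: padic_ext => k /=.
  by rewrite mod0z; apply: contrapT => hk; apply: h; exists k; apply/eqP.
have [i hi] := nz _ x0; have [j hj] := nz _ y0.
have := congr1 (fun z => pval z (i + j)) xy0; rewrite /= mod0z => /dvdz_mod0P.
rewrite (pval_eq0_le x (leq_addr j i)) in hi.
rewrite (pval_eq0_le y (leq_addl i j)) in hj.
move: hi hj; rewrite !dvdzE abszM /=.
move: `|pval x _|%N `|pval y _|%N => a b ha hb.
have a0 : (0 < a)%N by case: a ha => //; rewrite dvdn0.
have b0 : (0 < b)%N by case: b hb => //; rewrite dvdn0.
move: ha hb; rewrite !pfactor_dvdn ?muln_gt0 ?a0 // lognM // -!ltnNge => ha hb.
by move=> hab; have := leq_add ha (ltnW hb); rewrite addSn ltnNge hab.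
Qed.

HB.instance Definition _ := GRing.ComUnitRing_isIntegral.Build Zp padic_integral.

End PadicIntRing.

Notation padic hp := {fraction (padic_int hp)}.

(* l is the p-adic limit of u, where A is the ring of integers of R *)
Definition padic_lim (R : nzRingType) (A : R -> Prop) (p : nat)
    (u : nat -> R) (l : R) : Prop :=
  forall N : nat, exists J : nat, forall j : nat, (J <= j)%N ->
    exists2 b : R, A b & u j - l = p%:R ^+ N * b.

Section LocalField.
Variables (p : nat) (hp : prime p) (K : fieldExtType (padic hp)).

Definition padic_int_emb : padic_int hp -> K :=
  in_alg K \o @FracField.tofrac (padic_int hp).

Definition intring (x : K) : Prop := integralOver padic_int_emb x.

Definition intunit (x : K) : Prop :=
  intring x /\ exists2 y : K, intring y & x * y = 1.

(* O_K is local, so that its maximal ideal consists of the non-units *)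
Definition maxid (x : K) : Prop := intring x /\ ~ intunit x.

Definition uniformizer (t : K) : Prop :=
  forall x : K, maxid x <-> exists2 y : K, intring y & x = t * y.

Definition ramification_index (e : nat) : Prop :=
  exists2 t : K, uniformizer t & exists2 u : K, intunit u & p%:R = u * t ^+ e.

End LocalField.

Record weierstrass (K : Type) := Weierstrass { a1 : K; a2 : K; a3 : K; a4 : K; a6 : K }.

Inductive point (K : Type) := Infinity | Affine of K & K.
Arguments Infinity {K}.

Section WeierstrassCurve.
Variables (K : fieldType) (W : weierstrass K).
Local Notation a1 := (a1 W).
Local Notation a2 := (a2 W).
Local Notation a3 := (a3 W).
Local Notation a4 := (a4 W).
Local Notation a6 := (a6 W).

Definition discriminant : K :=
  let b2 := a1 ^+ 2 + 4%:R * a2 in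
  let b4 := 2%:R * a4 + a1 * a3 in
  let b6 := a3 ^+ 2 + 4%:R * a6 in
  let b8 := a1 ^+ 2 * a6 + 4%:R * a2 * a6 - a1 * a3 * a4 + a2 * a3 ^+ 2
            - a4 ^+ 2 in
  - b2 ^+ 2 * b8 - 8%:R * b4 ^+ 3 - 27%:R * b6 ^+ 2 + 9%:R * b2 * b4 * b6.

Definition elliptic : Prop := discriminant != 0.

Definition on_curve (P : point K) : Prop :=
  if P is Affine x y
  then y ^+ 2 + a1 * x * y + a3 * y = x ^+ 3 + a2 * x ^+ 2 + a4 * x + a6
  else True.

Definition pt_opp (P : point K) : point K :=
  if P is Affine x y then Affine x (- y - a1 * x - a3) else Infinity.

(* l is the slope of the chord, or of the tangent when P = Q *)
Definition pt_add (P Q : point K) : point K :=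
  match P, Q with
  | Infinity, _ => Q
  | _, Infinity => P
  | Affine x1 y1, Affine x2 y2 =>
      if (x1 == x2) && (y1 + y2 + a1 * x2 + a3 == 0) then Infinity else
      let l := if x1 == x2
               then (3%:R * x1 ^+ 2 + 2%:R * a2 * x1 + a4 - a1 * y1)
                    / (2%:R * y1 + a1 * x1 + a3)
               else (y2 - y1) / (x2 - x1) in
      let x3 := l ^+ 2 + a1 * l - a2 - x1 - x2 in
      Affine x3 (- (l + a1) * x3 - (y1 - l * x1) - a3)
  end.

Definition pt_muln (n : nat) (P : point K) : point K :=
  iter n (pt_add P) Infinity.

Definition pt_mulz (m : int) (P : point K) : point K :=
  match m with
  | Posz n => pt_muln n P
  | Negz n => pt_opp (pt_muln n.+1 P)
  end.

Definition hcoord (P : point K) : K * K * K :=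
  if P is Affine x y then (x, y, 1) else (0, 1, 0).

(* Partial derivatives of                                                    *)
(*   Y^2 Z + a1 XYZ + a3 YZ^2 - X^3 - a2 X^2 Z - a4 X Z^2 - a6 Z^3           *)
Definition dX (X Y Z : K) : K :=
  a1 * Y * Z - 3%:R * X ^+ 2 - 2%:R * a2 * X * Z - a4 * Z ^+ 2.
Definition dY (X Y Z : K) : K :=
  2%:R * Y * Z + a1 * X * Z + a3 * Z ^+ 2.
Definition dZ (X Y Z : K) : K :=
  Y ^+ 2 + a1 * X * Y + 2%:R * a3 * Y * Z - a2 * X ^+ 2
  - 2%:R * a4 * X * Z - 3%:R * a6 * Z ^+ 2.

End WeierstrassCurve.

Section WeierstrassLocal.
Variables (p : nat) (hp : prime p) (K : fieldExtType (padic hp)).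
Variable W : weierstrass K.

(* [c x : c y : c z] are primitive homogeneous coordinates of P, whose       *)
(* classes modulo m_K are those of the reduction of P; vanishing in the      *)
(* residue field is membership in m_K.                                       *)
Definition nonsingular_reduction (P : point K) : Prop :=
  let: (x, y, z) := hcoord P in
  exists c : K,
    let X := c * x in let Y := c * y in let Z := c * z in
    [/\ [/\ intring X, intring Y & intring Z],
        ~ [/\ maxid X, maxid Y & maxid Z]
      & ~ [/\ maxid (dX W X Y Z), maxid (dY W X Y Z) & maxid (dZ W X Y Z)]].

Definition E0 (P : point K) : Prop := on_curve W P /\ nonsingular_reduction P.

(* Topology of P^2(K) as a quotient of K^3 \ 0: some homogeneous coordinates *)
(* of the P j converge to homogeneous coordinates of Q.                      *)
Definition pt_lim (P : nat -> point K) (Q : point K) : Prop :=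
  exists2 c : nat -> K, (forall j, c j != 0) &
    let: (x, y, z) := hcoord Q in
    [/\ padic_lim (@intring p hp K) p (fun j => c j * (hcoord (P j)).1.1) x,
        padic_lim (@intring p hp K) p (fun j => c j * (hcoord (P j)).1.2) y
      & padic_lim (@intring p hp K) p (fun j => c j * (hcoord (P j)).2) z].

(* Q = a P for the Z_p-module structure: Q is the limit of m_j P for all     *)
(* integers m_j converging to a.                                             *)
Definition is_padic_scale (a : padic_int hp) (P Q : point K) : Prop :=
  forall m : nat -> int,
    padic_lim (fun _ : padic_int hp => True) p (fun j => (m j)%:~R) a ->
    pt_lim (fun j => pt_mulz W (m j) P) Q.

End WeierstrassLocal.

(* Main.v *)
From HB Require Import structures.
Require Import Defs.
From mathcomp Require Import all_boot all_order all_algebra all_field.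
From mathcomp Require Import boolp.
From mathcomp Require Import ring zify.

(* In the chart (z, w) = (-x/y, -1/y) the group E_0(K) is parametrized by
   z in O_K, and, the a_i being in m_K, addition is given by rational formulas
   whose denominators are units.  Give z, w, a_i the weights -1, -3, i.  Such
   formulas preserve the functions on a cube {0,1}^r all of whose mixed
   differences are divisible by the increments and by the expected power of
   m_K^(1/6); hence the n-th forward difference of m |-> z(mP) at 0 is divisible
   by z(P)^n with a coefficient of valuation at least (n-1)/6.  Newton's formula
     z(pP) = sum_i C(p,i) Delta^i
   then gives z(pP) = p z(P) (1 + r z(P)) with r in m_K as soon as 6e < p - 1.
   So log P = lim z(p^k P) / p^k exists, is additive, and differs from z by a
   contraction; it is therefore a bijection from E_0(K) onto O_K, which is free
   of rank n over Z_p.  Associativity is a field identity for generic triples,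
   extended by continuity in the z-coordinates. *)

Set Implicit Arguments.
Unset Strict Implicit.
Unset Printing Implicit Defensive.

Import Order.TTheory GRing.Theory Num.Theory.
Local Open Scope ring_scope.

(** * The chord and tangent law in the chart (z, w) = (-x/y, -1/y) *)

(** A point of E_0(K) has z in O_K but not always in m_K, so powers of z bring no smallness and the
    coefficients must supply all of it. As a power series in z(P), z(mP) has an n-th coefficient
    that is isobaric of weight n - 1 in the a_i; as i <= 6, each a_i has valuation at least 1 >=
    i/6, and this is the origin of the 6 in the hypothesis. Mixed differences carry the same
    information through rational expressions, so that no power series is expanded. The loss from
    fractional weights is harmless: valuations are integers, so any positive lower bound already
    means membership in m_K. *)

Section ChordTangent.
Variables (K : fieldType) (W : weierstrass K).
Local Notation a1 := (a1 W).
Local Notation a2 := (a2 W).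
Local Notation a3 := (a3 W).
Local Notation a4 := (a4 W).
Local Notation a6 := (a6 W).

Definition chord_point (l x1 y1 x2 : K) : point K :=
  let x3 := l ^+ 2 + a1 * l - a2 - x1 - x2 in
  Affine x3 (- (l + a1) * x3 - (y1 - l * x1) - a3).

Lemma pt_add_chord x1 y1 x2 y2 : x1 != x2 ->
  pt_add W (Affine x1 y1) (Affine x2 y2) =
  chord_point ((y2 - y1) / (x2 - x1)) x1 y1 x2.
Proof. by move=> h; rewrite /pt_add (negPf h). Qed.

Definition xcoord (P : point K) : K := if P is Affine x _ then x else 0.

(* On the line y = l x + m through P1 and P2 the curve is
   (x - x1)(x - x2)(x - x5), and a3 is determined by a third point off that
   line, so associativity becomes an identity between rational functions of
   free variables. *)
Lemma pt_add_assoc_generic x1 y1 x2 y2 x3 y3 :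
  let P1 := Affine x1 y1 in let P2 := Affine x2 y2 in
  let P3 := Affine x3 y3 in
  on_curve W P1 -> on_curve W P2 -> on_curve W P3 ->
  x1 != x2 -> x2 != x3 -> x1 != x3 ->
  xcoord (pt_add W P1 P2) != x3 -> x1 != xcoord (pt_add W P2 P3) ->
  pt_add W (pt_add W P1 P2) P3 = pt_add W P1 (pt_add W P2 P3).
Proof.
move=> P1 P2 P3 c1 c2 c3 h12 h23 h13.
rewrite /P1 /P2 /P3 (pt_add_chord _ _ h12) (pt_add_chord _ _ h23) /chord_point /xcoord.
set l := (y2 - y1) / (x2 - x1); set l3 := (y3 - y2) / (x3 - x2).
set x5 := l ^+ 2 + _ - _ - _ - _; set x7 := l3 ^+ 2 + _ - _ - _ - _.
move=> h53 h17; rewrite !pt_add_chord // /chord_point.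
have E12 : x2 - x1 != 0 by rewrite subr_eq0 eq_sym.
have E32 : x3 - x2 != 0 by rewrite subr_eq0 eq_sym.
have E13 : x3 - x1 != 0 by rewrite subr_eq0 eq_sym.
have E35 : x3 - x5 != 0 by rewrite subr_eq0 eq_sym.
have E71 : x7 - x1 != 0 by rewrite subr_eq0 eq_sym.
pose m := y1 - l * x1; pose d := y3 - l * x3 - m.
have y1E : y1 = l * x1 + m by rewrite /m; ring.
have y2E : y2 = l * x2 + m by rewrite /m /l; field.
have y3E : y3 = l * x3 + m + d by rewrite /d; ring.
have a2E : a2 = l ^+ 2 + a1 * l - x1 - x2 - x5 by rewrite /x5; ring.
have dE : d * (d + 2%:R * (l * x3 + m) + a1 * x3 + a3)
          = (x3 - x1) * (x3 - x2) * (x3 - x5).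
  pose h x y := y ^+ 2 + a1 * x * y + a3 * y - (x ^+ 3 + a2 * x ^+ 2 + a4 * x + a6).
  have h1 : h x1 y1 = 0 by rewrite /h c1 subrr.
  have h2 : h x2 y2 = 0 by rewrite /h c2 subrr.
  have h3 : h x3 y3 = 0 by rewrite /h c3 subrr.
  apply: (mulfI E12); apply/eqP; rewrite -subr_eq0; apply/eqP.
  (* The combination of the three curve equations in which a4 and a6 cancel. *)
  transitivity ((x2 - x1) * h x3 y3 - (x2 - x3) * h x1 y1 - (x3 - x1) * h x2 y2).
    by rewrite /h a2E y1E y2E y3E; ring.
  by rewrite h1 h2 h3; ring.
have d0 : d != 0.
  apply: contraNneq (mulf_neq0 (mulf_neq0 E13 E32) E35) => d0.
  by rewrite -dE d0 mul0r.
have a3E : a3 = (x3 - x1) * (x3 - x2) * (x3 - x5) / d - d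
                - 2%:R * (l * x3 + m) - a1 * x3.
  by rewrite -dE; field.
have l3E : l3 = l + d / (x3 - x2).
  by rewrite /l3 y2E y3E; field.
have x7E : x7 = l3 ^+ 2 + a1 * l3 - a2 - x2 - x3 by [].
clearbody x5 l l3 x7 m d.
rewrite l3E a2E in x7E.
have h71 := E71; rewrite x7E in h71.
rewrite a2E a3E l3E y1E y3E y2E x7E.
(* The numerator of x7 - x1 over (x3 - x2)^2, in the shape in which [field] asks for it. *)
have h71' : (l * (x3 - x2) + d) ^+ 2 + a1 * (l * (x3 - x2) + d) * (x3 - x2) +
      - (l ^+ 2 + a1 * l - x1 - x2 - x5) * ((x3 - x2) * (x3 - x2)) +
      - x2 * ((x3 - x2) * (x3 - x2)) + - x3 * ((x3 - x2) * (x3 - x2)) +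
      - x1 * ((x3 - x2) * (x3 - x2)) != 0.
  apply: contraNneq h71 => h; rewrite -(mulIr_eq0 _ (mulIf (mulf_neq0 E32 E32))).
  by rewrite -h; apply/eqP; field.
by congr Affine; field; rewrite h71' d0 E32 E35.
Qed.


Definition chart_eq (z w : K) : K :=
  z ^+ 3 + a1 * z * w + a2 * z ^+ 2 * w + a3 * w ^+ 2 + a4 * z * w ^+ 2
  + a6 * w ^+ 3 - w.

(* The difference of the chart equations at two points is
   (z2 - z1) N = (w2 - w1) sden, and slope = N / sden is also the slope of the
   tangent when the points coincide. *)
Definition sden (z1 w1 z2 w2 : K) : K :=
  1 - a1 * z1 - a2 * z1 ^+ 2 - a3 * (w1 + w2) - a4 * z1 * (w1 + w2)
  - a6 * (w1 ^+ 2 + w1 * w2 + w2 ^+ 2).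
Definition slope (z1 w1 z2 w2 : K) : K :=
  (z1 ^+ 2 + z1 * z2 + z2 ^+ 2 + a1 * w2 + a2 * (z1 + z2) * w2 + a4 * w2 ^+ 2)
  / sden z1 w1 z2 w2.
Definition icpt (z1 w1 z2 w2 : K) : K := w1 - slope z1 w1 z2 w2 * z1.

(* Coefficients of z^3 and z^2 in chart_eq z (l z + n). *)
Definition lcub (l : K) : K := 1 + a2 * l + a4 * l ^+ 2 + a6 * l ^+ 3.
Definition lsqr (l n : K) : K :=
  a1 * l + a2 * n + a3 * l ^+ 2 + 2%:R * a4 * l * n + 3%:R * a6 * l ^+ 2 * n.

(** With x = z/w and y = -1/w, the ordinate - y - a1 x - a3 of the opposite point is
    [nden z w / w]. *)
Definition nden (z w : K) : K := 1 - a1 * z - a3 * w.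
Definition cneg (P : K * K) : K * K :=
  (- (P.1 / nden P.1 P.2), - (P.2 / nden P.1 P.2)).

Definition third (P Q : K * K) : K * K :=
  let l := slope P.1 P.2 Q.1 Q.2 in let n := icpt P.1 P.2 Q.1 Q.2 in
  let z := - P.1 - Q.1 - lsqr l n / lcub l in (z, l * z + n).

Definition cadd (P Q : K * K) : K * K := cneg (third P Q).

Lemma slope_secant z1 w1 z2 w2 :
  chart_eq z1 w1 = 0 -> chart_eq z2 w2 = 0 -> sden z1 w1 z2 w2 != 0 ->
  slope z1 w1 z2 w2 * (z2 - z1) = w2 - w1.
Proof.
move=> c1 c2 D0; apply: (mulIf D0); rewrite /slope mulrAC divfK //.
apply/eqP; rewrite -subr_eq0; apply/eqP.
transitivity (chart_eq z2 w2 - chart_eq z1 w1); last by rewrite c1 c2 subrr.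
by rewrite /chart_eq /sden; ring.
Qed.

(** Nothing is divided by z2 - z1: the defining relation of the slope is used instead, so that a
    tangent line gets its double root from the same identity. *)
Lemma chart_eq_line z1 w1 z2 w2 z :
  chart_eq z1 w1 = 0 -> chart_eq z2 w2 = 0 -> sden z1 w1 z2 w2 != 0 ->
  let l := slope z1 w1 z2 w2 in let n := icpt z1 w1 z2 w2 in
  chart_eq z (l * z + n) =
  (z - z1) * (z - z2) * (lcub l * (z + z1 + z2) + lsqr l n).
Proof.
move=> c1 c2 D0; have := slope_secant c1 c2 D0; rewrite /icpt.
have : slope z1 w1 z2 w2 * sden z1 w1 z2 w2 =
  z1 ^+ 2 + z1 * z2 + z2 ^+ 2 + a1 * w2 + a2 * (z1 + z2) * w2 + a4 * w2 ^+ 2.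
  by rewrite /slope divfK.
move: (slope _ _ _ _) => l /eqP; rewrite -subr_eq0 => /eqP e1 e2.
have w2E : w2 = w1 + l * (z2 - z1) by rewrite e2; ring.
apply/eqP; rewrite -subr_eq0; apply/eqP.
transitivity (chart_eq z1 w1 + (z1 - z) * (l * sden z1 w1 z2 w2 -
  (z1 ^+ 2 + z1 * z2 + z2 ^+ 2 + a1 * w2 + a2 * (z1 + z2) * w2 + a4 * w2 ^+ 2))).
  by rewrite w2E /sden /chart_eq /lcub /lsqr; ring.
by rewrite c1 e1 mulr0 addr0.
Qed.

Lemma chart_eq_third P Q :
  chart_eq P.1 P.2 = 0 -> chart_eq Q.1 Q.2 = 0 ->
  sden P.1 P.2 Q.1 Q.2 != 0 -> lcub (slope P.1 P.2 Q.1 Q.2) != 0 ->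
  chart_eq (third P Q).1 (third P Q).2 = 0.
Proof.
move=> c1 c2 D0 A0; rewrite /third /= chart_eq_line //.
by move: (slope _ _ _ _) A0 => l A0; field.
Qed.

Lemma chart_eq_neg P : nden P.1 P.2 != 0 -> chart_eq P.1 P.2 = 0 ->
  chart_eq (cneg P).1 (cneg P).2 = 0.
Proof.
case: P => z w /= D0 c; rewrite -[RHS](mul0r (- (nden z w)^-1 ^+ 3)) -c.
by rewrite /chart_eq; move: D0; rewrite /nden => D0; field.
Qed.

Lemma chart_eq_inj z w1 w2 :
  chart_eq z w1 = 0 -> chart_eq z w2 = 0 -> sden z w1 z w2 != 0 -> w1 = w2.
Proof.
move=> c1 c2 D0; apply/eqP; rewrite eq_sym -subr_eq0.
by rewrite -(slope_secant c1 c2 D0) subrr mulr0.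
Qed.

Lemma chart_eq_w0 z : chart_eq z 0 = 0 -> z = 0.
Proof.
move=> c; have : z ^+ 3 == 0 by rewrite -c /chart_eq; apply/eqP; ring.
by rewrite expf_eq0 => /eqP.
Qed.

Lemma chart_eq0 : chart_eq 0 0 = 0. Proof. by rewrite /chart_eq; ring. Qed.

Definition chart (P : K * K) : point K :=
  if P.2 == 0 then Infinity else Affine (P.1 / P.2) (- P.2^-1).

Lemma chart_on_curve P : chart_eq P.1 P.2 = 0 -> on_curve W (chart P).
Proof.
case: P => z w /= c; rewrite /chart /=; case: eqVneq => //= w0.
apply/eqP; rewrite -subr_eq0; apply/eqP.
by rewrite -[RHS](mul0r (- w ^- 3)) -c /chart_eq; field.
Qed.

Lemma chart_inj P Q : chart_eq P.1 P.2 = 0 -> chart_eq Q.1 Q.2 = 0 ->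
  chart P = chart Q -> P = Q.
Proof.
case: P Q => [z w] [z' w'] /= c c'; rewrite /chart /=.
case: eqVneq c => [->|w0] c; case: eqVneq c' => [->|w'0] c' //.
  by rewrite (chart_eq_w0 c) (chart_eq_w0 c').
case=> ex /oppr_inj/invr_inj ew; rewrite ew in ex *.
by rewrite (divIf w'0 ex).
Qed.

Lemma chart_neg P : nden P.1 P.2 != 0 -> chart (cneg P) = pt_opp W (chart P).
Proof.
case: P => z w; rewrite /chart /= => D0.
rewrite oppr_eq0 mulf_eq0 invr_eq0 (negPf D0) orbF.
case: eqVneq => //= w0; move: D0; rewrite /nden => D0.
rewrite invrN mulrN mulNr !opprK invf_div; congr Affine.
  by field; rewrite D0 w0.
by field.
Qed.

(** [sden] and the numerator of [slope] treat the two points differently. For z1 != z2 both orders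
    give the secant slope; for z1 = z2 the points coincide. *)
Lemma slopeC z1 w1 z2 w2 :
  chart_eq z1 w1 = 0 -> chart_eq z2 w2 = 0 -> sden z1 w1 z2 w2 != 0 ->
  sden z2 w2 z1 w1 != 0 -> slope z1 w1 z2 w2 = slope z2 w2 z1 w1.
Proof.
move=> c1 c2 D0 D0'; have [ez|nz] := eqVneq z2 z1.
  rewrite {}ez in c2 D0 D0' *.
  by have ew := chart_eq_inj c2 c1 D0'; rewrite ew.
apply: (mulIf (_ : z2 - z1 != 0)); first by rewrite subr_eq0.
by rewrite slope_secant // -(opprB w1) -(slope_secant c2 c1) // -mulrN opprB.
Qed.

Lemma thirdC P Q :
  chart_eq P.1 P.2 = 0 -> chart_eq Q.1 Q.2 = 0 ->
  sden P.1 P.2 Q.1 Q.2 != 0 -> sden Q.1 Q.2 P.1 P.2 != 0 ->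
  third P Q = third Q P.
Proof.
move=> c1 c2 D D'; rewrite /third.
have -> : icpt P.1 P.2 Q.1 Q.2 = icpt Q.1 Q.2 P.1 P.2.
  rewrite /icpt -(slopeC c1 c2 D D'); apply/eqP; rewrite -subr_eq0; apply/eqP.
  transitivity (slope P.1 P.2 Q.1 Q.2 * (Q.1 - P.1) - (Q.2 - P.2)); first by ring.
  by rewrite slope_secant // subrr.
rewrite [- P.1 - Q.1]addrC (slopeC c1 c2 D D'); congr pair.
Qed.

Lemma caddC P Q :
  chart_eq P.1 P.2 = 0 -> chart_eq Q.1 Q.2 = 0 ->
  sden P.1 P.2 Q.1 Q.2 != 0 -> sden Q.1 Q.2 P.1 P.2 != 0 ->
  cadd P Q = cadd Q P.
Proof. by move=> *; rewrite /cadd thirdC. Qed.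

(** A line through the origin has intercept 0. The slope relation then reads lcub l * z2^2 + z2 *
    lsqr l 0 = l, which says, without dividing by z2, that Q is opposite to the third point. *)
Lemma cadd0 Q : chart_eq Q.1 Q.2 = 0 -> sden 0 0 Q.1 Q.2 != 0 ->
  lcub (slope 0 0 Q.1 Q.2) != 0 ->
  nden (third (0, 0) Q).1 (third (0, 0) Q).2 != 0 ->
  cadd (0, 0) Q = Q.
Proof.
case: Q => z2 w2 /= c D0; rewrite /cadd /third /cneg /=.
have := slope_secant chart_eq0 c D0; rewrite !subr0 /icpt mulr0 subr0.
have : slope 0 0 z2 w2 * sden 0 0 z2 w2 =
    z2 ^+ 2 + a1 * w2 + a2 * z2 * w2 + a4 * w2 ^+ 2.
  by rewrite /slope divfK // expr0n mul0r !add0r.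
move: (slope _ _ _ _) => l e1 e2 A0; rewrite -{}e2 in e1 c D0 *.
set z3 := - 0 - z2 - _.
have {e1} e1 : lcub l * z2 ^+ 2 + z2 * lsqr l 0 = l.
  apply/eqP; rewrite -subr_eq0; apply/eqP.
  transitivity (z2 ^+ 2 + a1 * (l * z2) + a2 * z2 * (l * z2) + a4 * (l * z2) ^+ 2
    - l * sden 0 0 z2 (l * z2)); last by rewrite e1 subrr.
  by rewrite /lcub /lsqr /sden; ring.
rewrite addr0 => n0.
suff e : - (z3 / nden z3 (l * z3)) = z2 by rewrite -mulrA e -mulrN e.
apply: (mulIf n0); rewrite mulNr divfK //; apply: (mulfI A0).
have z3E : lcub l * z3 = - lcub l * z2 - lsqr l 0 by rewrite /z3; field.
transitivity (lcub l * z2 - (a1 + a3 * l) * z2 * (lcub l * z3)).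
  rewrite mulrN z3E.
  transitivity (lcub l * z2 + (a1 + a3 * l) * (lcub l * z2 ^+ 2 + z2 * lsqr l 0)).
    by rewrite e1 /lsqr; ring.
  by ring.
by rewrite /nden; ring.
Qed.

(** For n != 0 the line w = l z + n is y = (l/n) x - 1/n; for n = 0 it is vertical, and the third
    point is the origin. The relations between the roots of the cubic in z count multiplicity, so
    only the slope used by [pt_add] distinguishes chords from tangents. *)
Lemma chart_cadd P Q :
  chart_eq P.1 P.2 = 0 -> chart_eq Q.1 Q.2 = 0 ->
  P.2 != 0 -> Q.2 != 0 ->
  sden P.1 P.2 Q.1 Q.2 != 0 -> lcub (slope P.1 P.2 Q.1 Q.2) != 0 ->
  nden (third P Q).1 (third P Q).2 != 0 ->
  chart (cadd P Q) = pt_add W (chart P) (chart Q).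
Proof.
case: P Q => [z1 w1] [z2 w2] /= c1 c2 w10 w20 D0 A0 n30.
rewrite /cadd chart_neg //.
have c3 := @chart_eq_third (z1, w1) (z2, w2) c1 c2 D0 A0.
have secE := slope_secant c1 c2 D0.
have lineE z := @chart_eq_line _ _ _ _ z c1 c2 D0.
move: c3 lineE n30 A0 secE; rewrite /third /=.
set l := slope z1 w1 z2 w2; set n := icpt z1 w1 z2 w2.
have lD : l * sden z1 w1 z2 w2 = z1 ^+ 2 + z1 * z2 + z2 ^+ 2 + a1 * w2
    + a2 * (z1 + z2) * w2 + a4 * w2 ^+ 2 by rewrite /l /slope divfK.
have w1E : w1 = l * z1 + n by rewrite /n /icpt -/l; ring.
have w2E : w2 = l * z2 + n.
  rewrite -[LHS](subrK w1) -(slope_secant c1 c2 D0) -/l; rewrite [X in _ + X]w1E; ring.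
set z3 := - z1 - z2 - _; set w3 := l * z3 + n => c3 lineE n30 A0 secE.
have BE : lsqr l n = - lcub l * (z1 + z2 + z3) by rewrite /z3; field.
clearbody z3 n l.
(* [C0E] and [C1E] compare the constant and linear coefficients of the cubic with those of its
   factorization, by evaluation at 0 and 1. *)
have C0E : n - a3 * n ^+ 2 - a6 * n ^+ 3 = lcub l * (z1 * z2 * z3).
  transitivity (- chart_eq 0 (l * 0 + n)); first by rewrite /chart_eq; ring.
  by rewrite lineE BE; ring.
have C1E : a1 * n + 2%:R * a3 * l * n + a4 * n ^+ 2 + 3%:R * a6 * l * n ^+ 2 - l
    = lcub l * (z1 * z2 + z1 * z3 + z2 * z3).
  transitivity (chart_eq 1 (l * 1 + n) - lcub l - lsqr l n
                - chart_eq 0 (l * 0 + n)).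
    by rewrite /chart_eq /lcub /lsqr; ring.
  by rewrite !lineE BE; ring.
have prodE : lcub l * (w1 * w2 * w3) = n ^+ 3.
  transitivity (l ^+ 3 * (lcub l * (z1 * z2 * z3))
    + l ^+ 2 * n * (lcub l * (z1 * z2 + z1 * z3 + z2 * z3))
    - l * n ^+ 2 * lsqr l n + lcub l * n ^+ 3).
    by rewrite BE w1E w2E /w3; ring.
  by rewrite -C0E -C1E /lsqr /lcub; ring.
(* Divided by [prodE] this is x1 + x2 + x3 = (l/n)^2 + a1 (l/n) - a2, the abscissa formula of
   [pt_add]. *)
have sumE : lcub l * (z1 * w2 * w3 + z2 * w1 * w3 + z3 * w1 * w2)
    = l ^+ 2 * n + a1 * l * n ^+ 2 - a2 * n ^+ 3.
  transitivity (3%:R * l ^+ 2 * (lcub l * (z1 * z2 * z3))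
    + 2%:R * l * n * (lcub l * (z1 * z2 + z1 * z3 + z2 * z3))
    - n ^+ 2 * lsqr l n).
    by rewrite BE w1E w2E /w3; ring.
  by rewrite -C0E -C1E /lsqr /lcub; ring.
have w3E : w3 = l * z3 + n by []; clearbody w3.
have [w30|w30] := eqVneq w3 0.
  have n0 : n = 0.
    have : n ^+ 3 == 0 by rewrite -prodE w30 !mulr0.
    by rewrite expf_eq0 => /eqP.
  move: w1E w2E; rewrite n0 !addr0 => w1E w2E.
  have l0 : l != 0 by apply: contraNneq w10 => l0; rewrite w1E l0 mul0r.
  have z10 : z1 != 0 by apply: contraNneq w10 => e; rewrite w1E e mulr0.
  have z20 : z2 != 0 by apply: contraNneq w20 => e; rewrite w2E e mulr0.
  have z30 : z3 = 0 by apply: chart_eq_w0; move: c3; rewrite w30.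
  have e2 : - l = lcub l * (z1 * z2).
    by move: C1E; rewrite n0 z30 !mulr0 !addr0 => <-; ring.
  rewrite /chart /= !(negPf w10, negPf w20) w30 eqxx /= w1E w2E.
  have -> : z1 / (l * z1) = l^-1 by field; rewrite l0 z10.
  have -> : z2 / (l * z2) = l^-1 by field; rewrite l0 z20.
  have e1 : lcub l * (z1 + z2) = - (a1 * l + a3 * l ^+ 2).
    by rewrite -[z1 + z2]addr0 -z30 -[LHS]opprK -mulNr -BE n0 /lsqr; ring.
  rewrite eqxx (_ : _ + a3 = 0) ?eqxx //.
  transitivity ((- (l * (lcub l * (z1 + z2))) + (a1 + a3 * l) * l * (lcub l * (z1 * z2)))
    / (lcub l * l ^+ 2 * z1 * z2)).
    by field; rewrite A0 l0 z10 z20.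
  by rewrite e1 -e2; field; rewrite A0 l0 z10 z20.
have n0 : n != 0.
  have : lcub l * (w1 * w2 * w3) != 0 by rewrite !mulf_neq0.
  by rewrite prodE expf_eq0.
rewrite {1}/chart (negPf w30) /= /chart /= (negPf w10) (negPf w20).
suff -> : pt_add W (Affine (z1 / w1) (- w1^-1)) (Affine (z2 / w2) (- w2^-1))
  = chord_point (l / n) (z1 / w1) (- w1^-1) (z2 / w2).
  have x3E : (l / n) ^+ 2 + a1 * (l / n) - a2 - z1 / w1 - z2 / w2 = z3 / w3.
    transitivity (lcub l * (z1 * w2 * w3 + z2 * w1 * w3 + z3 * w1 * w2)
        / (lcub l * (w1 * w2 * w3)) - z1 / w1 - z2 / w2).
      by rewrite sumE prodE; field; rewrite ?n0 ?w10 ?w20.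
    by field; rewrite w10 w20 w30 A0.
  rewrite /chord_point x3E; congr Affine.
  have y1E : - w1^-1 = l / n * (z1 / w1) - n^-1.
    by rewrite w1E; field; rewrite n0 -w1E w10.
  have y3E : - w3^-1 = l / n * (z3 / w3) - n^-1.
    by rewrite w3E; field; rewrite n0 -w3E w30.
  by rewrite y1E y3E; ring.
have [ex|nx] := eqVneq (z1 / w1) (z2 / w2); last first.
  rewrite pt_add_chord //; congr chord_point.
  have z21 : z2 - z1 != 0.
    apply: contraNneq nx => /eqP; rewrite subr_eq0 => /eqP e.
    by rewrite w1E w2E e.
  have -> : - w2^-1 - - w1^-1 = l * (z2 - z1) / (w1 * w2).
    by rewrite secE; field; rewrite w10 w20.
  have -> : z2 / w2 - z1 / w1 = n * (z2 - z1) / (w1 * w2).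
    transitivity ((z2 * w1 - z1 * w2) / (w1 * w2)); first by field; rewrite w10 w20.
    by congr (_ / _); rewrite w1E w2E; ring.
  by field; rewrite w10 w20 n0 z21.
have zE : z2 = z1.
  apply/eqP; rewrite -subr_eq0 -(mulrI_eq0 _ (mulfI n0)); apply/eqP.
  transitivity (z2 * w1 - z1 * w2); first by rewrite w1E w2E; ring.
  by move/eqP: ex; rewrite eqr_div // => /eqP ->; rewrite mulrC subrr.
have wE : w2 = w1 by rewrite w1E w2E zE.
move: c2 w20 D0 lD; rewrite {}zE {}wE.
move=> {ex w2E z2 w2 secE lineE sumE prodE C1E C0E BE} _ _ D0 lD.
have TE : 2%:R * (- w1^-1) + a1 * (z1 / w1) + a3 = n * sden z1 w1 z1 w1 / w1 ^+ 2.
  transitivity ((w1 - l * z1) * sden z1 w1 z1 w1 / w1 ^+ 2); last first.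
    by rewrite {1}w1E; congr (_ * _ / _); ring.
  rewrite mulrBl mulrAC lD.
  (* At a double point [sden] and the numerator of [slope] are, up to sign, the partial derivatives
     of [chart_eq]; adding 3 times the equation is Euler's relation for the homogenized cubic. *)
  transitivity ((w1 * sden z1 w1 z1 w1 - z1 * (z1 ^+ 2 + z1 * z1 + z1 ^+ 2 + a1 * w1
    + a2 * (z1 + z1) * w1 + a4 * w1 ^+ 2) + 3%:R * chart_eq z1 w1) / w1 ^+ 2).
    by rewrite /sden /chart_eq; field.
  by rewrite c1; congr (_ / _); ring.
have T0 : n * sden z1 w1 z1 w1 / w1 ^+ 2 != 0.
  by rewrite !mulf_neq0 ?invr_eq0 ?expf_neq0.
rewrite /pt_add eqxx /= (_ : - w1^-1 + - w1^-1 + a1 * (z1 / w1) + a3 =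
  2%:R * (- w1^-1) + a1 * (z1 / w1) + a3); last by ring.
rewrite TE (negPf T0) /chord_point.
suff -> : (3%:R * (z1 / w1) ^+ 2 + 2%:R * a2 * (z1 / w1) + a4 - a1 * - w1^-1)
  / (n * sden z1 w1 z1 w1 / w1 ^+ 2) = l / n by [].
apply: (mulIf T0); rewrite divfK //.
transitivity ((l * sden z1 w1 z1 w1) / w1 ^+ 2); last by field; rewrite w10 n0.
by rewrite lD; field.
Qed.

End ChordTangent.

(** * p-adic integers and integral elements *)

Section PadicIntegers.
Variables (p : nat) (hp : prime p).
Local Notation Zp := (padic_int hp).
Local Notation q k := (Posz (p ^ k)%N).
Implicit Types x y : Zp.

Lemma pvalD x y k : pval (x + y) k = ((pval x k + pval y k) %% q k)%Z.
Proof. by []. Qed.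
Lemma pvalM x y k : pval (x * y) k = ((pval x k * pval y k) %% q k)%Z.
Proof. by []. Qed.
Lemma pval1 k : pval (1 : Zp) k = (1 %% q k)%Z.
Proof. by []. Qed.

Lemma pval_natr n k : pval (n%:R : Zp) k = (n%:Z %% q k)%Z.
Proof.
elim: n => [|n IH]; first by rewrite mulr0n.
by rewrite -addn1 natrD pvalD IH pval1 modzDm PoszD.
Qed.

Lemma pval_mulp x j k : pval (p%:R ^+ k * x) j = ((q k * pval x j) %% q j)%Z.
Proof. by rewrite pvalM -natrX pval_natr modzMml. Qed.

Lemma pval_congr x y k b : x - y = p%:R ^+ k * b -> pval x k = pval y k.
Proof.
move=> h; rewrite -[x](subrK y) h pvalD pval_mulp modzDml.
by rewrite -modzDml modzMr add0r pval_mod.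
Qed.

Lemma padic_dvdp x : pval x 1 = 0 -> exists y, x = p%:R * y.
Proof.
move=> x0; have dvdx j : (p %| pval x j.+1)%Z.
  by have := pval_eq0_le x (isT : 1 <= j.+1)%N; rewrite x0 eqxx expn1.
have p0 : p%:Z != 0 by rewrite eqz_nat -lt0n prime_gt0.
have divK j : p%:Z * (pval x j.+1 %/ p)%Z = pval x j.+1.
  by rewrite mulrC divzK.
(* Dividing by p costs one digit: the quotient modulo p^k is read off x modulo p^(k+1). *)
have hy k : ((pval x k.+2 %/ p)%Z = (pval x k.+1 %/ p)%Z %[mod q k])%Z.
  apply/eqP; rewrite eqz_mod_dvd -(dvdz_mul2l p0).
  by rewrite mulrBr !divK -PoszM -expnS -eqz_mod_dvd pval_next.
exists (padic_of hp hy); apply: padic_ext => k.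
rewrite -[p%:R]expr1 pval_mulp expn1 /= modzMmr divK.
by rewrite pval_next pval_mod.
Qed.

(** Bezout gives an inverse modulo each p^k; inverses modulo p^k are unique, so these are compatible
    and define a p-adic integer. *)
Lemma padic_unitP x : pval x 1 != 0 -> exists y, y * x = 1.
Proof.
move=> x1; have cop k : coprimez (pval x k) (q k).
  case: k => [|k]; first by rewrite coprimezE expn0 coprimen1.
  rewrite coprimezE absz_nat coprime_pexpr // coprime_sym prime_coprime //.
  apply: contra x1 => h.
  by rewrite (pval_eq0_le x (isT : 1 <= k.+1)%N) expn1.
have bez k : exists u : int, (u * pval x k = 1 %[mod q k])%Z.
  have /coprimezP[[u v] /= uv] := cop k; exists u.
  by rewrite -uv addrC -modzDml modzMl add0r.
have {bez} [f fP] := choice bez.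
have hf k : (f k.+1 = f k %[mod q k])%Z.
  apply/eqP; rewrite eqz_mod_dvd -(Gauss_dvdzl _ (p := pval x k)); last first.
    by rewrite coprimez_sym.
  rewrite mulrBl -eqz_mod_dvd fP -modzMmr -pval_next modzMmr.
  by rewrite -modz_modq fP modz_modq.
exists (padic_of hp hf); apply: padic_ext => k.
by rewrite pvalM /= modzMml fP.
Qed.

Lemma padic_dvd x k : pval x k = 0 -> exists y, x = p%:R ^+ k * y.
Proof.
elim: k x => [|k IH] x x0; first by exists x; rewrite mul1r.
have [|y xE] := padic_dvdp (x := x).
  by apply/eqP; rewrite (pval_eq0_le x (isT : 1 <= k.+1)%N) x0 dvdz0.
have [|b yE] := IH y; last by exists b; rewrite xE yE mulrA -exprS.
have p0 : p%:Z != 0 by rewrite eqz_nat -lt0n prime_gt0.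
move: x0; rewrite xE -[p%:R]expr1 pval_mulp expn1 => /dvdz_mod0P.
rewrite expnS PoszM (dvdz_mul2l p0) => /dvdz_mod0P.
by rewrite -pvalP.
Qed.

Lemma padic_sub_dvd x y k :
  pval x k = pval y k -> exists b, x - y = p%:R ^+ k * b.
Proof.
by move=> h; apply: padic_dvd; rewrite pvalD /= modzDmr h subrr mod0z.
Qed.

Lemma padic_complete (u : nat -> Zp) :
  (forall k, exists b, u k.+1 - u k = p%:R ^+ k * b) ->
  exists l, forall k, exists b, u k - l = p%:R ^+ k * b.
Proof.
move=> hu.
have hl k : (pval (u k.+1) k.+1 = pval (u k) k %[mod q k])%Z.
  by have [b /pval_congr hb] := hu k; rewrite pval_next hb.
by exists (padic_of hp hl) => k; apply: padic_sub_dvd; rewrite /= pval_mod.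
Qed.

Lemma padic_p_neq0 : p%:R != 0 :> Zp.
Proof.
have p1 := prime_gt1 hp; apply/eqP => /(congr1 (fun x => pval x 2)).
rewrite pval_natr /= mod0z modz_small; first by move=> [] pE; rewrite pE in p1.
by rewrite le0z_nat ltz_nat -[X in (X < _)%N]expn1 ltn_exp2l.
Qed.

Lemma padic_eq0 x : (forall k, exists b, x = p%:R ^+ k * b) -> x = 0.
Proof.
move=> h; apply: padic_ext => k; have [b xE] := h k.
by rewrite (pval_congr (y := 0) (b := b)) ?subr0.
Qed.

Lemma padic_p_nonunit x : p%:R * x != 1.
Proof.
apply/eqP => /(congr1 (fun x => pval x 1)).
rewrite -[p%:R]expr1 pval_mulp expn1 modzMr pval1 modz_small //.
by rewrite ltz_nat prime_gt1.
Qed.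

Lemma padic_decomp x : x != 0 -> exists k y, x = p%:R ^+ k * y /\ exists z, z * y = 1.
Proof.
move=> x0; have [k xk] : exists k, pval x k != 0.
  apply: contrapT => h; case/eqP: x0; apply: padic_ext => k /=; rewrite mod0z.
  by apply: contrapT => hk; apply: h; exists k; apply/eqP.
elim: k x {x0} xk => [|k IH] x xk.
  by move: xk; rewrite -pval_mod modz1 eqxx.
have [x1|/padic_unitP[z zx]] := eqVneq (pval x 1) 0; last first.
  by exists 0%N, x; rewrite mul1r; split=> //; exists z.
have [y xE] := padic_dvdp x1.
have yk : pval y k != 0.
  apply: contra xk => /eqP/padic_dvd[b yE].
  by rewrite xE yE mulrA -exprS pval_mulp modzMr.
have [j [z [yE hz]]] := IH _ yk.
by exists j.+1, z; rewrite xE yE mulrA -exprS.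
Qed.

End PadicIntegers.

Section IntegerRing.
Variables (p : nat) (hp : prime p) (K : fieldExtType (padic hp)).
Local Notation Zp := (padic_int hp).
Local Notation iota := (padic_int_emb K).
Local Notation O := (@intring p hp K).

HB.instance Definition _ := GRing.RMorphism.copy (padic_int_emb K)
  (in_alg K \o @FracField.tofrac (padic_int hp)).

Arguments padic_int_emb : simpl never.

Lemma iota_inj : injective iota.
Proof.
move=> x y /fmorph_inj/eqP; rewrite tofrac_eq => /eqP; exact.
Qed.

Lemma p_neq0 : p%:R != 0 :> K.
Proof.
apply/eqP; rewrite -(rmorph_nat iota) -(rmorph0 iota) => /iota_inj.
exact/eqP/padic_p_neq0.
Qed.

Lemma intring_emb x : O (iota x). Proof. exact: integral_id. Qed.
Lemma intring_nat n : O n%:R. Proof. exact: integral_nat. Qed.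
Lemma intring0 : O 0. Proof. exact: intring_nat 0%N. Qed.
Lemma intring1 : O 1. Proof. exact: intring_nat 1%N. Qed.
Lemma intringD x y : O x -> O y -> O (x + y).
Proof. exact: integral_add. Qed.
Lemma intringB x y : O x -> O y -> O (x - y).
Proof. exact: integral_sub. Qed.
Lemma intringM x y : O x -> O y -> O (x * y).
Proof. exact: integral_mul. Qed.
Lemma intringX x n : O x -> O (x ^+ n).
Proof.
by move=> Ox; elim: n => [|n IH]; [exact: intring1 | rewrite exprS; exact: intringM].
Qed.
Lemma intring_sum (I : Type) (r : seq I) (P : pred I) (F : I -> K) :
  (forall i, P i -> O (F i)) -> O (\sum_(i <- r | P i) F i).
Proof. exact: (big_ind O intring0 intringD). Qed.

(** A monic equation of degree d for 1/p, multiplied by p^d, would exhibit 1 as a multiple of p in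
    Z_p. *)
Lemma inv_p_notin_intring : ~ O p%:R^-1.
Proof.
case=> f mf; rewrite /root => /eqP f0.
have [d sf] : exists d, size f = d.+1.
  by exists (size f).-1; rewrite prednK // lt0n size_poly_eq0 monic_neq0.
have fd : f`_d = 1 by have := monicP mf; rewrite lead_coefE sf.
have hd : p%:R ^+ d != 0 :> K by rewrite expf_neq0 // p_neq0.
have cf i : (map_poly iota f)`_i = iota f`_i by exact: coef_map.
move: f0; rewrite (horner_coef_wide (n := d.+1)); last first.
  by rewrite -sf size_poly.
rewrite big_ord_recr cf fd (rmorph1 iota) mul1r exprVn.
move/(congr1 ( *%R (p%:R ^+ d))); rewrite mulrDr divff // mulr0 mulr_sumr.
move/eqP; rewrite addr_eq0 => /eqP hs.
have /negP[] := padic_p_nonunit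
  (- \sum_(i < d) p%:R ^+ (d - i.+1) * f`_i : Zp).
apply/eqP; apply: iota_inj; rewrite (rmorph1 iota) -[RHS]opprK -hs.
rewrite mulrN (rmorphN iota) mulr_sumr (rmorph_sum iota); congr (- _).
apply: eq_bigr => i _ /=; rewrite [in LHS]mulrA -exprS -subSn // subSS cf.
rewrite (rmorphM iota) (rmorphXn iota) (rmorph_nat iota) exprVn.
rewrite [RHS]mulrCA [LHS]mulrC; congr (_ * _).
have hi : p%:R ^+ i != 0 :> K by rewrite expf_neq0 // p_neq0.
by apply: (mulIf hi); rewrite divfK // -exprD subnK // ltnW.
Qed.

Lemma frac_num_den (R : idomainType) (c : {fraction R}) :
  exists2 d : R, d != 0 & exists n, c * FracField.tofrac d = FracField.tofrac n.
Proof.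
elim/quotW: c => -[[n d] /= d0]; exists d => //; exists n.
rewrite !piE; apply/eqmodP; rewrite /= FracField.equivfE /FracField.mulf.
rewrite !numden_Ratio ?oner_neq0 ?mulr1 //=.
by rewrite mulrC.
Qed.

Lemma padic_denominator (c : padic hp) :
  exists N x, p%:R ^+ N * c = FracField.tofrac x.
Proof.
have [d d0 [n cd]] := frac_num_den c.
have [N [y [dE [z zy]]]] := padic_decomp d0.
exists N, (n * z).
rewrite tofracM -cd dE tofracM tofracXn (rmorph_nat (@FracField.tofrac Zp)).
have zyF : FracField.tofrac y * FracField.tofrac z = 1.
  by rewrite -tofracM mulrC zy tofrac1.
by rewrite -[LHS]mulr1 -zyF; ring.
Qed.

(** If g is the minimal polynomial of x, of degree d, then p^N x is a root of the monic polynomial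
    with coefficients p^(N(d-i)) g_i, which are integral once p^N clears the denominators of g. *)
Lemma intring_denominator (x : K) : exists N, O (p%:R ^+ N * x).
Proof.
have /polyOver1P[f fE] := minPolyOver 1 x.
have mg := monic_minPoly 1 x; have := root_minPoly 1 x.
set g := minPoly 1 x in mg fE *; rewrite /root => /eqP gx0.
have [d sg] : exists d, size g = d.+1.
  by exists (size g).-1; rewrite prednK // lt0n size_poly_eq0 monic_neq0.
have gd : g`_d = 1 by have := monicP mg; rewrite lead_coefE sg.
have gO i : exists N, O (p%:R ^+ N * g`_i).
  have [N [y yE]] := padic_denominator f`_i; exists N.
  have -> : p%:R ^+ N * g`_i = iota y; last exact: intring_emb.
  have e : (p%:R ^+ N : padic hp)%:A = p%:R ^+ N :> K.
    by rewrite -in_algE rmorphXn rmorph_nat.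
  rewrite fE coef_map [RHS]/padic_int_emb /= -yE -scalerA -e.
  by rewrite -scalerAl mul1r.
have {gO} [M MP] := choice gO.
pose N := (\sum_(i < d) M i)%N; exists N.
have NO i : (i < d)%N -> O (p%:R ^+ N * g`_i).
  move=> id; have -> : N = (N - M i + M i)%N.
    by rewrite subnK // /N (bigD1 (Ordinal id)) //= leq_addr.
  by rewrite exprD -mulrA; apply: intringM (MP i); apply/intringX/intring_nat.
pose r := \poly_(i < d.+1) (p%:R ^+ (N * (d - i)) * g`_i).
have rd : r`_d = 1 by rewrite coef_poly ltnSn subnn muln0 mul1r gd.
have sr : size r = d.+1.
  apply/anti_leq; rewrite size_poly /= ltnNge; apply/negP.
  by move/leq_sizeP/(_ _ (leqnn _)); rewrite rd; apply/eqP/oner_neq0.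
apply: (@integral_root_monic _ _ _ _ r).
- by apply/monicP; rewrite lead_coefE sr.
- apply/eqP; transitivity (p%:R ^+ (N * d) * g.[x]); last by rewrite gx0 mulr0.
  rewrite !(@horner_coef_wide _ d.+1) ?sr ?sg // mulr_sumr.
  apply: eq_bigr => i _; rewrite coef_poly ltn_ord exprMn.
  rewrite [in RHS](_ : N * d = N * (d - i) + N * i)%N; last first.
    by rewrite -mulnDr subnK // -ltnS.
  by rewrite exprD -exprM; ring.
- apply/integral_poly => i; rewrite coef_poly; case: ltnP => hi; last exact: intring0.
  move: hi; rewrite ltnS leq_eqVlt => /orP[/eqP->|hi].
    by rewrite subnn muln0 mul1r gd; apply: intring1.
  rewrite -(prednK (n := d - i)) ?subn_gt0 // mulnS addnC exprD -mulrA.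
  by apply: intringM; [apply/intringX/intring_nat | apply: NO].
Qed.

End IntegerRing.

(** * The valuation given by a uniformizer *)

(* The value at 0 is junk. *)
Record dvaluation (K : fieldType) := DValuation {
  dval :> K -> int;
  dvalM : forall x y, x != 0 -> y != 0 -> dval (x * y) = dval x + dval y;
  dvalD : forall x y, x != 0 -> y != 0 -> x + y != 0 ->
    dval x <= dval y -> dval x <= dval (x + y);
  dval_surj : exists2 t, t != 0 & dval t = 1
}.

Section ValuationTheory.
Variables (K : fieldType) (v : dvaluation K).
Implicit Types (x y : K) (k : int).

(* Values are rescaled by 6 so that a coefficient a_i of positive valuation
   can be given weight i. *)
Definition wge k x : bool := (x == 0) || (k <= 6%:Z * v x).

Lemma wge0x k : wge k 0. Proof. by rewrite /wge eqxx. Qed.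

Lemma wge_le j k x : j <= k -> wge k x -> wge j x.
Proof. by move=> jk; rewrite /wge => /orP[->|h] //; apply/orP; right; lia. Qed.

Lemma dval1 : v 1 = 0.
Proof.
have := dvalM v (oner_neq0 K) (oner_neq0 K); rewrite mulr1.
by move: (v 1) => a; lia.
Qed.

Lemma dvalN x : v (- x) = v x.
Proof.
have [->|x0] := eqVneq x 0; first by rewrite oppr0.
have N0 : - 1 != 0 :> K by rewrite oppr_eq0 oner_neq0.
have := dvalM v N0 N0; rewrite mulrNN mulr1 dval1 => h.
by rewrite -mulN1r dvalM //; lia.
Qed.

Lemma dvalV x : x != 0 -> v x^-1 = - v x.
Proof.
move=> x0; have := dvalM v x0 (invr_neq0 x0).
by rewrite divff // dval1; lia.
Qed.

Lemma wgeN k x : wge k x -> wge k (- x).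
Proof. by rewrite /wge oppr_eq0 dvalN. Qed.

Lemma wgeD k x y : wge k x -> wge k y -> wge k (x + y).
Proof.
have [->|x0] := eqVneq x 0; first by rewrite add0r.
have [->|y0] := eqVneq y 0; first by rewrite addr0.
rewrite /wge (negPf x0) (negPf y0) /= => hx hy.
have [//|s0 /=] := eqVneq (x + y) 0.
have [h|h] := lerP (v x) (v y).
  by have := dvalD x0 y0 s0 h; move: (v (x + y)) => a; lia.
by rewrite addrC in s0 *; have := dvalD y0 x0 s0 (ltW h); move: (v (y + x)) => a; lia.
Qed.

Lemma wgeB k x y : wge k x -> wge k y -> wge k (x - y).
Proof. by move=> hx hy; apply: wgeD hx (wgeN hy). Qed.

Lemma wgeM j k x y : wge j x -> wge k y -> wge (j + k) (x * y).
Proof.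
have [->|x0] := eqVneq x 0; first by rewrite mul0r !wge0x.
have [->|y0] := eqVneq y 0; first by rewrite mulr0 !wge0x.
rewrite /wge mulf_eq0 (negPf x0) (negPf y0) /= dvalM //; lia.
Qed.

Lemma wge_nat n : wge 0 n%:R.
Proof.
elim: n => [|n IH]; first exact: wge0x.
by rewrite -addn1 natrD wgeD // /wge dval1 oner_eq0.
Qed.

Lemma wgeX n k x : wge k x -> wge (k *+ n) (x ^+ n).
Proof.
move=> h; elim: n => [|n IH]; first by rewrite mulr0n; apply: wge_nat 1%N.
by rewrite exprS mulrS wgeM.
Qed.

(** Rescaled valuations are multiples of 6, so a bound can be rounded up: this turns a gain of 1/6
    into membership in m_K. *)
Lemma wge_ceil k x : wge (6%:Z * k - 5%:Z) x -> wge (6%:Z * k) x.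
Proof. by rewrite /wge => /orP[->|h] //; apply/orP; right; lia. Qed.

Definition vunit x : bool := (x != 0) && (v x == 0).

Lemma vunit_neq0 x : vunit x -> x != 0. Proof. by case/andP. Qed.
Lemma vunitV x : vunit x -> vunit x^-1.
Proof. by case/andP=> x0 /eqP vx; rewrite /vunit invr_eq0 x0 dvalV // vx. Qed.
Lemma vunit_wge x : vunit x -> wge 0 x.
Proof. by case/andP=> x0 /eqP vx; rewrite /wge vx orbT. Qed.

Lemma vunit_1D x : wge 1 x -> vunit (1 + x).
Proof.
move=> hx; have n0 : 1 + x != 0.
  apply: contraL hx; rewrite addrC addr_eq0 => /eqP ->.
  by rewrite /wge oppr_eq0 oner_eq0 dvalN dval1.
rewrite /vunit n0 /=.
have h1 : wge 0 (1 + x) by apply: wgeD (wge_nat 1) (wge_le _ hx).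
have h2 : ~~ wge 1 (1 + x).
  apply/negP => h; have := wgeB h hx; rewrite addrK.
  by rewrite /wge oner_eq0 dval1.
by move: h1 h2; rewrite /wge (negPf n0) /=; lia.
Qed.

Lemma wge_all_eq0 x : (forall k : nat, wge (6%:Z * k%:Z) x) -> x = 0.
Proof.
move=> h; apply/eqP; have := h `|v x|.+1; rewrite /wge => /orP[//|].
by lia.
Qed.

(** Convergence at the fixed rate k: the iterations below meet it, and no modulus has to be carried
    along. *)
Definition vcauchy (u : nat -> K) : Prop :=
  forall k : nat, wge (6%:Z * k%:Z) (u k.+1 - u k).
Definition vlim (u : nat -> K) (l : K) : Prop :=
  forall k : nat, wge (6%:Z * k%:Z) (u k - l).
Definition vcomplete : Prop :=
  forall u, wge 0 (u 0%N) -> vcauchy u -> exists l, vlim u l.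

Lemma vcauchy_le u (j k : nat) : vcauchy u -> (j <= k)%N ->
  wge (6%:Z * j%:Z) (u k - u j).
Proof.
move=> hu /subnK <-; elim: (k - j)%N => [|i IH]; first by rewrite subrr wge0x.
rewrite addSn -[u _](subrK (u (i + j)%N)) -addrA; apply: wgeD IH.
by apply: wge_le (hu _); lia.
Qed.

Lemma vlim_unique u l l' : vlim u l -> vlim u l' -> l = l'.
Proof.
move=> h h'; apply/eqP; rewrite -subr_eq0; apply/eqP/wge_all_eq0 => k.
have -> : l - l' = (u k - l') - (u k - l) by ring.
exact: wgeB.
Qed.

Lemma vcomplete_fixpoint (g : K -> K) : vcomplete ->
  (forall x, wge 0 x -> wge 0 (g x)) ->
  (forall x y, wge 0 x -> wge 0 y ->
     exists2 r, wge 6 r & g x - g y = r * (x - y)) ->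
  exists2 x, wge 0 x & g x = x.
Proof.
move=> complete gO gC; pose u n := iter n g 0.
have uO n : wge 0 (u n) by elim: n => [|n IH] /=; [exact: wge0x | exact: gO].
have [|l lP] := complete u (uO 0%N).
  elim=> [|k IH]; first by rewrite mulr0; apply: wgeB.
  have [r r6 ->] := gC _ _ (uO k.+1) (uO k).
  by apply: wge_le (wgeM r6 IH); lia.
have lO : wge 0 l.
  by have := wgeB (uO 0%N) (lP 0%N); rewrite opprB addrC subrK.
exists l => //; apply/eqP; rewrite -subr_eq0; apply/eqP/wge_all_eq0 => k.
have -> : g l - l = (u k.+1 - l) - (g (u k) - g l) by rewrite /u /=; ring.
have [r r6 ->] := gC _ _ (uO k) lO.
apply: wgeB; first by apply: wge_le (lP k.+1); lia.
by apply: wge_le (wgeM r6 (lP k)); lia.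
Qed.

End ValuationTheory.

Section RamificationValuation.
Variables (p : nat) (hp : prime p) (K : fieldExtType (padic hp)).
Local Notation O := (@intring p hp K).
Variables (e : nat) (t u : K) (ht : uniformizer t) (hu : intunit u)
  (pE : p%:R = u * t ^+ e).

Lemma intunitP (x : K) : intunit x <-> [/\ x != 0, O x & O x^-1].
Proof.
split=> [[Ox [y Oy xy]]|[x0 Ox Ox']]; last first.
  by split=> //; exists x^-1; rewrite ?divff.
have x0 : x != 0 by apply: contra_eq_neq xy => ->; rewrite mul0r eq_sym oner_neq0.
by split=> //; rewrite -[x^-1]mulr1 -xy mulKf.
Qed.

Lemma intunitM (x y : K) : intunit x -> intunit y -> intunit (x * y).
Proof.
move=> /intunitP[x0 Ox Ox'] /intunitP[y0 Oy Oy']; apply/intunitP.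
by rewrite mulf_neq0 // invfM; split=> //; apply: intringM.
Qed.

Lemma intunitV (x : K) : intunit x -> intunit x^-1.
Proof.
move=> /intunitP[x0 Ox Ox']; apply/intunitP.
by rewrite invr_eq0 invrK; split.
Qed.

Lemma intunitX (x : K) n : intunit x -> intunit (x ^+ n).
Proof.
move=> /intunitP[x0 Ox Ox']; apply/intunitP.
by rewrite expf_neq0 // -exprVn; split=> //; apply: intringX.
Qed.

Lemma maxid_unif : maxid t.
Proof. by apply/ht; exists 1; rewrite ?mulr1 //; apply: intring1. Qed.

Lemma unif_neq0 : t != 0.
Proof.
have [t0|//] := eqVneq t 0.
have [|y Oy] := (ht p%:R).1; last first.
  by rewrite t0 mul0r => /eqP; rewrite (negPf (p_neq0 _)).
split; first exact: intring_nat.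
by case/intunitP => _ _ /inv_p_notin_intring.
Qed.

Lemma unif_pow_nonunit k : ~ intunit (t ^+ k.+1).
Proof.
move/intunitP=> [_ _ h]; case: maxid_unif => Ot; apply; apply/intunitP.
split=> //; first exact: unif_neq0.
have -> : t^-1 = t ^+ k * (t ^+ k.+1)^-1; last exact/intringM/h/intringX.
by rewrite exprS invfM mulrCA divff ?mulr1 // expf_neq0 // unif_neq0.
Qed.

(** Otherwise x is divisible by every power of t, hence of p. With p^N / x integral, 1/p = (x /
    p^(N+1)) (p^N / x) would then be integral. *)
Lemma intring_unif_decomp (x : K) : O x -> x != 0 ->
  exists k : nat, intunit (x / t ^+ k).
Proof.
move=> Ox x0; apply: contrapT => h.
have t0 := unif_neq0.
have {}h k : O (x / t ^+ k).
  elim: k => [|k IH]; first by rewrite divr1.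
  have [|y Oy yE] := (ht (x / t ^+ k)).1.
    by split=> // hk; apply: h; exists k.
  suff -> : x / t ^+ k.+1 = y by [].
  by apply: (mulfI t0); rewrite -yE exprS; field; rewrite t0 expf_neq0.
have [N ON] := intring_denominator x^-1.
apply: (@inv_p_notin_intring p hp K).
have p0 := p_neq0 K.
have -> : p%:R^-1 = (x / p%:R ^+ N.+1) * (p%:R ^+ N * x^-1).
  by rewrite exprS; field; rewrite x0 p0 expf_neq0.
apply: intringM => //.
rewrite pE exprMn invfM mulrCA -exprM; apply: intringM => //.
by have /intunitV/intunitP[] := intunitX N.+1 hu.
Qed.

Lemma unif_decomp (x : K) : x != 0 -> exists k : int, intunit (x / t ^ k).
Proof.
move=> x0; have [N ON] := intring_denominator x.
have t0 := unif_neq0; have p0 := p_neq0 K.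
have [|k hk] := intring_unif_decomp ON.
  by rewrite mulf_neq0 // expf_neq0.
exists (k%:Z - (e * N)%N%:Z).
have -> : x / t ^ (k%:Z - (e * N)%N%:Z) = p%:R ^+ N * x / t ^+ k * (u ^+ N)^-1.
  have u0 : u != 0 by case/intunitP: hu.
  rewrite expfzDr // -exprnN -exprnP pE exprMn exprM.
  rewrite invfM invrK -exprM; field.
  by rewrite !expf_neq0.
exact/intunitM/intunitV/intunitX.
Qed.

Lemma unif_decomp_uniq (x : K) (j k : int) :
  intunit (x / t ^ j) -> intunit (x / t ^ k) -> j = k.
Proof.
have t0 := unif_neq0.
wlog jk : j k / j < k => [IH hj hk|hj hk].
  have [/IH|/IH|//] := ltgtP j k; first exact.
  by move=> h; rewrite h.
case: (@unif_pow_nonunit `|k - j|.-1); rewrite prednK ?absz_gt0; last by lia.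
have -> : t ^+ `|k - j| = (x / t ^ j) / (x / t ^ k).
  have /intunitP[h0 _ _] := hk.
  have x0 : x != 0 by apply: contraNneq h0 => ->; rewrite mul0r.
  have tj : t ^ j != 0 by rewrite expfz_neq0.
  have tk : t ^ k != 0 by rewrite expfz_neq0.
  rewrite invfM invrK mulrACA divff // mul1r exprnP gez0_abs; last by lia.
  by rewrite expfzDr // mulrC invr_expz.
exact/intunitM/intunitV.
Qed.

Definition tval (x : K) : int :=
  if pselect (x != 0) is left x0 then projT1 (cid (unif_decomp x0)) else 0.

Lemma tvalP (x : K) k : x != 0 -> intunit (x / t ^ k) <-> tval x = k.
Proof.
move=> x0; rewrite /tval; case: pselect => // x0'.
have h := projT2 (cid (unif_decomp x0')).
by split=> [|<-] //; apply: unif_decomp_uniq.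
Qed.

Lemma tvalM (x y : K) : x != 0 -> y != 0 -> tval (x * y) = tval x + tval y.
Proof.
move=> x0 y0; apply/tvalP; first by rewrite mulf_neq0.
rewrite expfzDr ?unif_neq0 // invfM mulrACA.
by apply: intunitM; apply/tvalP.
Qed.

Lemma tval_ge0 (x : K) : x != 0 -> O x <-> 0 <= tval x.
Proof.
move=> x0; split=> [Ox|h].
  by have [k hk] := intring_unif_decomp Ox x0; rewrite ((tvalP k%:Z x0).1 hk).
have /intunitP[_ Oh _] := (tvalP (tval x) x0).2 erefl.
rewrite -[x](divfK (_ : t ^ tval x != 0)); last by rewrite expfz_neq0 // unif_neq0.
apply: intringM => //; rewrite -(gez0_abs h); apply: intringX.
by case: maxid_unif.
Qed.

Lemma tvalD (x y : K) : x != 0 -> y != 0 -> x + y != 0 ->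
  tval x <= tval y -> tval x <= tval (x + y).
Proof.
move=> x0 y0 s0 h.
have e1 : x + y = x * (1 + y / x) by rewrite mulrDr mulr1 mulrCA divff ?mulr1.
have z0 : 1 + y / x != 0.
  by apply: contraNneq s0 => z0; rewrite e1 z0 mulr0.
rewrite e1 tvalM // lerDl; apply/tval_ge0 => //; apply: intringD; first exact: intring1.
apply/tval_ge0; first by rewrite mulf_neq0 ?invr_neq0.
have yx0 : y / x != 0 by rewrite mulf_neq0 ?invr_neq0.
have : tval y = tval (y / x) + tval x by rewrite -tvalM ?divfK.
by move: h; lia.
Qed.

Lemma tval_unif : tval t = 1.
Proof.
have t0 := unif_neq0; apply/tvalP => //.
rewrite expr1z divff //; apply/intunitP.
by rewrite invr1 oner_neq0; split=> //; exact: intring1.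
Qed.

Definition ram_valuation : dvaluation K :=
  DValuation tvalM tvalD (ex_intro2 _ _ t unif_neq0 tval_unif).

Lemma ram_wge0 (x : K) : O x <-> wge ram_valuation 0 x.
Proof.
rewrite /wge; have [->|x0] := eqVneq x 0; first by split=> // _; apply: intring0.
by rewrite (tval_ge0 x0) /=; split; lia.
Qed.

Lemma ram_maxid (x : K) : maxid x <-> wge ram_valuation 6 x.
Proof.
have t0 := unif_neq0.
rewrite ht /wge; have [->|x0] := eqVneq x 0.
  by split=> // _; exists 0; rewrite ?mulr0 //; apply: intring0.
have tx := tvalM t0 (mulf_neq0 x0 (invr_neq0 t0)).
rewrite mulrCA divff // mulr1 tval_unif in tx.
split=> [[y Oy xE]|/= h].
  have y0 : y != 0 by apply: contraNneq x0 => y0; rewrite xE y0 mulr0.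
  by move/(tval_ge0 y0): Oy; rewrite /= xE tvalM // tval_unif; lia.
exists (x / t); last by rewrite mulrCA divff ?mulr1.
apply/tval_ge0; first by rewrite mulf_neq0 ?invr_neq0.
have : 6 <= 6%:Z * tval x := h.
by rewrite tx; move: (tval (x / t)) => a; lia.
Qed.

Lemma ram_p : ram_valuation p%:R = e.
Proof.
have u0 : u != 0 by case/intunitP: hu.
apply/tvalP; first exact: p_neq0.
by rewrite pE -exprnP mulfK // expf_neq0 // unif_neq0.
Qed.

Lemma ram_gt0 : (0 < e)%N.
Proof.
have := ram_wge0 p%:R^-1; rewrite /wge invr_eq0 (negPf (p_neq0 _)) /= => h.
have hV := dvalV ram_valuation (p_neq0 K); rewrite ram_p in hV.
rewrite lt0n; apply/negP => /eqP e0; apply: (@inv_p_notin_intring p hp K).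
by apply/h; move: hV; rewrite e0 /= => ->.
Qed.

End RamificationValuation.

Lemma ramification_valuation (p : nat) (hp : prime p)
    (K : fieldExtType (padic hp)) (e : nat) : ramification_index K e ->
  exists v : dvaluation K,
    [/\ forall x, intring x <-> wge v 0 x, forall x, maxid x <-> wge v 6 x,
        v p%:R = e & (0 < e)%N].
Proof.
case=> t ht [u hu pE]; exists (ram_valuation ht hu pE); split.
- exact: ram_wge0.
- exact: ram_maxid.
- exact: ram_p.
- exact: ram_gt0 hu pE.
Qed.

(** * The ring of integers as a lattice *)

Section IntegerLattice.
Variables (p : nat) (hp : prime p) (K : fieldExtType (padic hp)).
Local Notation Zp := (padic_int hp).
Local Notation iota := (padic_int_emb K).
Local Notation O := (@intring p hp K).

Definition comb r (X : 'I_r -> K) (c : 'rV[Zp]_r) : K :=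
  \sum_i iota (c 0 i) * X i.

Lemma combB r (X : 'I_r -> K) c d : comb X (c - d) = comb X c - comb X d.
Proof.
rewrite /comb -sumrB; apply: eq_bigr => i _.
by rewrite !mxE (rmorphB iota) mulrBl.
Qed.

Lemma combD r (X : 'I_r -> K) c d : comb X (c + d) = comb X c + comb X d.
Proof.
rewrite /comb -big_split; apply: eq_bigr => i _.
by rewrite !mxE (rmorphD iota) mulrDl.
Qed.

Lemma combZ r (X : 'I_r -> K) a c : comb X (a *: c) = iota a * comb X c.
Proof.
rewrite /comb mulr_sumr; apply: eq_bigr => i _.
by rewrite !mxE (rmorphM iota) mulrA.
Qed.

Lemma combZp r (X : 'I_r -> K) k c :
  comb X (p%:R ^+ k *: c) = p%:R ^+ k * comb X c.
Proof. by rewrite combZ (rmorphXn iota) (rmorph_nat iota). Qed.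

Lemma comb_intring r (X : 'I_r -> K) c : (forall i, O (X i)) -> O (comb X c).
Proof.
by move=> OX; apply: intring_sum => i _; apply: intringM => //; apply: intring_emb.
Qed.

(** Linear independence over F_p of classes in O_K / p O_K, phrased with coefficients lifted to
    Z_p. *)
Definition indep_modp r (X : 'I_r -> K) : Prop :=
  (forall i, O (X i)) /\
  (forall c y, O y -> comb X c = p%:R * y -> exists c', c = p%:R *: c').

Lemma indep_modp_inj r (X : 'I_r -> K) c :
  indep_modp X -> comb X c = 0 -> c = 0.
Proof.
case=> OX indX c0; apply/rowP => i; rewrite mxE; apply: padic_eq0 => k.
have [d -> _] : exists2 d, c = p%:R ^+ k *: d & comb X d = 0.
  elim: k => [|k [d cE d0]]; first by exists c; rewrite // scale1r.
  have [|d' dE] := indX d 0 (intring0 _); first by rewrite mulr0.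
  exists d'; first by rewrite cE dE scalerA -exprSr.
  move: d0; rewrite dE -[p%:R]expr1 combZp => /eqP.
  by rewrite mulf_eq0 expf_eq0 (negPf (p_neq0 _)) => /eqP.
by exists (d 0 i); rewrite mxE.
Qed.

Lemma common_denominator r (k : 'I_r -> padic hp) :
  exists N (c : 'I_r -> Zp), forall i, p%:R ^+ N * k i = FracField.tofrac (c i).
Proof.
have [M MP] := choice (fun i => padic_denominator (k i)).
have [d dP] := choice MP.
exists (\sum_i M i)%N, (fun i => p%:R ^+ (\sum_i M i - M i) * d i) => i.
rewrite tofracM -dP mulrA tofracXn (rmorph_nat (@FracField.tofrac Zp)) -exprD subnK //.
by rewrite (bigD1 i) //= leq_addr.
Qed.

Lemma indep_modp_free r (X : 'I_r -> K) : indep_modp X -> free [tuple X i | i < r].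
Proof.
move=> indX; apply/freeP => k hk i.
have [N [c cP]] := common_denominator k.
have cE : \row_i c i = 0.
  apply: (indep_modp_inj indX).
  transitivity ((p%:R ^+ N : padic hp) *: \sum_i k i *: [tuple X i | i < r]`_i).
    rewrite /comb scaler_sumr; apply: eq_bigr => j _.
    by rewrite mxE (nth_mktuple _ _ j) scalerA cP /padic_int_emb /= mulr_algl.
  by rewrite hk scaler0.
have := cP i; have /rowP/(_ i) := cE; rewrite !mxE => ->; rewrite tofrac0 => /eqP.
rewrite mulf_eq0 expf_eq0 -(rmorph_nat (@FracField.tofrac Zp)) tofrac_eq0.
by rewrite (negPf (padic_p_neq0 _)) andbF => /eqP.
Qed.

Lemma indep_modp_le r (X : 'I_r -> K) : indep_modp X -> (r <= \dim {:K})%N.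
Proof.
move=> /indep_modp_free; rewrite /free size_tuple => /eqP <-.
exact/dimvS/subvf.
Qed.

(** Families independent modulo p are free over Q_p, so their size is bounded by the degree. A
    maximal one turns out to be a basis of O_K, and neither trace form nor discriminant is
    involved. *)
Lemma indep_modp_max :
  exists r (X : 'I_r -> K), indep_modp X /\
    forall Y : 'I_r.+1 -> K, ~ indep_modp Y.
Proof.
pose P r := `[< exists X : 'I_r -> K, indep_modp X >].
have P0 : exists r, P r.
  exists 0%N; apply/asboolP; exists (fun=> 0); split=> [[]//|c y _ _].
  by exists 0; rewrite scaler0 (thinmx0 c).
have Pb r : P r -> (r <= \dim {:K})%N.
  by case/asboolP => X; apply: indep_modp_le.
case: (ex_maxnP P0 Pb) => r /asboolP[X indX] maxr.
exists r, X; split=> // Y indY.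
have : P r.+1 by apply/asboolP; exists Y.
by move/maxr; rewrite ltnn.
Qed.

(** Adjoining x to X gives a relation that is nontrivial modulo p. If p divides the coefficient of
    x, the relation descends to X and is trivial after all; otherwise that coefficient is a unit of
    Z_p and the relation is solved for x. *)
Lemma modp_span r (X : 'I_r -> K) : indep_modp X ->
  (forall Y : 'I_r.+1 -> K, ~ indep_modp Y) ->
  forall x, O x -> exists c y, O y /\ x = comb X c + p%:R * y.
Proof.
move=> [OX indX] maxX x Ox.
pose Y i := if unlift ord0 i is Some j then X j else x.
have OY i : O (Y i) by rewrite /Y; case: unliftP.
have combY c : comb Y c = iota (c 0 ord0) * x + comb X (\row_j c 0 (lift ord0 j)).
  rewrite /comb big_ord_recl /Y unlift_none; congr (_ + _).
  by apply: eq_bigr => j _; rewrite liftK mxE.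
have [c [y [Oy cy nc]]] : exists c y, [/\ O y, comb Y c = p%:R * y &
    ~ exists c', c = p%:R *: c'].
  apply: contrapT => h; apply: (maxX Y); split=> // c y Oy cy.
  by apply: contrapT => nc; apply: h; exists c, y.
rewrite combY in cy; set d := \row_j _ in cy.
have [/padic_dvdp[b cb]|/padic_unitP[z zc]] := eqVneq (pval (c 0 ord0) 1) 0.
  case: nc; have [||d' dE] := indX d (y - iota b * x).
  - by apply: intringB => //; apply: intringM => //; apply: intring_emb.
  - by rewrite mulrBr -cy cb (rmorphM iota) (rmorph_nat iota); ring.
  exists (\row_i if unlift ord0 i is Some j then d' 0 j else b).
  apply/rowP => i; rewrite !mxE; case: unliftP => [j ->|-> //].
  by have /rowP/(_ j) := dE; rewrite !mxE.
exists (- z *: d), (iota z * y); split.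
  by apply: intringM => //; apply: intring_emb.
rewrite combZ (rmorphN iota) mulrCA -cy mulrDr mulrA -(rmorphM iota) zc.
by rewrite (rmorph1 iota); ring.
Qed.

(** Successive approximation: [modp_span] is applied again to each remainder. The partial sums
    converge coordinatewise in Z_p, so completeness of O_K is not presupposed; separatedness
    identifies the limit with x. *)
Lemma comb_surj r (X : 'I_r -> K) :
  (forall x : K, (forall k, exists2 y, O y & x = p%:R ^+ k * y) -> x = 0) ->
  indep_modp X -> (forall Y : 'I_r.+1 -> K, ~ indep_modp Y) ->
  forall x, O x -> exists c, comb X c = x.
Proof.
move=> sepO indX maxX x Ox.
have /choice[F FP] (z : K) : exists cy : 'rV[Zp]_r * K,
    O z -> O cy.2 /\ z = comb X cy.1 + p%:R * cy.2.
  have [Oz|nO] := pselect (O z); last by exists (0, 0) => /nO.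
  have [c [y h]] := modp_span indX maxX Oz.
  by exists (c, y).
pose s k := iter k (fun z => (F z).2) x.
have Os k : O (s k) by elim: k => [|k IH] //=; have [] := FP _ IH.
pose C k := \sum_(j < k) p%:R ^+ j *: (F (s j)).1.
have CE k : x = comb X (C k) + p%:R ^+ k * s k.
  elim: k => [|k IH].
    by rewrite /C big_ord0 -(subrr 0) combB subrr add0r mul1r.
  rewrite /C big_ord_recr /= -/(C k) combD combZp {1}IH.
  by have [_ {1}->] := FP _ (Os k); rewrite exprSr; ring.
have [L LP] : exists L, forall k, exists b, C k - L = p%:R ^+ k *: b.
  have /choice[l lP] i : exists l, forall k, exists b, C k 0 i - l = p%:R ^+ k * b.
    apply: padic_complete => k; exists ((F (s k)).1 0 i).
    by rewrite /C big_ord_recr /= mxE addrAC subrr add0r mxE.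
  exists (\row_i l i) => k; have /choice[b bP] := fun i => lP i k.
  by exists (\row_i b i); apply/rowP => i; rewrite !mxE bP.
exists L; apply/eqP; rewrite eq_sym -subr_eq0; apply/eqP; apply: sepO => k.
have [b bE] := LP k; exists (comb X b + s k).
  by apply: intringD => //; apply: comb_intring indX.1.
by rewrite {1}(CE k) mulrDr -combZp -bE combB; ring.
Qed.

Lemma integer_basis :
  (forall x : K, (forall k, exists2 y, O y & x = p%:R ^+ k * y) -> x = 0) ->
  exists X : 'I_(\dim {:K}) -> K,
    [/\ forall i, O (X i), injective (comb X) &
        forall x, O x -> exists c, comb X c = x].
Proof.
move=> sepO; have [r [X [indX maxX]]] := indep_modp_max.
have surjX := comb_surj sepO indX maxX.
suff rE : r = \dim {:K}.
  case: _ / rE; exists X; split=> //.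
    by case: indX.
  move=> c d cd; apply/eqP; rewrite -subr_eq0; apply/eqP.
  by apply: (indep_modp_inj indX); rewrite combB cd subrr.
apply/anti_leq; rewrite (indep_modp_le indX) /=.
have := dim_span [tuple X i | i < r]; rewrite size_tuple; apply: leq_trans.
apply/dimvS/subvP => x _.
have [N /surjX[c cE]] := intring_denominator x.
have -> : x = (p%:R ^- N : padic hp) *: comb X c.
  rewrite cE -mulr_algl mulrA -in_algE fmorphV rmorphXn rmorph_nat mulVf ?mul1r //.
  by rewrite expf_neq0 // p_neq0.
apply/memvZ/memv_suml => i _; rewrite /padic_int_emb /= mulr_algl.
by apply/memvZ/memv_span; rewrite -(tnth_mktuple X i) mem_tnth.
Qed.

End IntegerLattice.

(** * Completeness of the ring of integers *)

Section Completeness.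
Variables (p : nat) (hp : prime p) (K : fieldExtType (padic hp)).
Variables (v : dvaluation K) (e : nat).
Hypotheses (v0 : forall x, intring x <-> wge v 0 x)
  (vp : v p%:R = e) (e0 : (0 < e)%N).
Local Notation O := (@intring p hp K).

Lemma dval_pX k : v (p%:R ^+ k) = (k * e)%N%:Z.
Proof.
elim: k => [|k IH]; first by rewrite dval1.
have p0 := p_neq0 K; rewrite exprS dvalM ?expf_neq0 // IH vp; lia.
Qed.

Lemma wge_pX (k : nat) x :
  (exists2 y, O y & x = p%:R ^+ k * y) <-> wge v (6%:Z * (e * k)%N%:Z) x.
Proof.
have p0 : p%:R ^+ k != 0 :> K by rewrite expf_neq0 // p_neq0.
split=> [[y /v0 Oy ->]|h].
  have := wgeM (j := 6%:Z * (e * k)%N%:Z) _ Oy; rewrite addr0; apply.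
  by rewrite /wge dval_pX mulnC lexx orbT.
exists (x / p%:R ^+ k); last by rewrite mulrCA divff ?mulr1.
apply/v0; have [->|x0] := eqVneq x 0; first by rewrite mul0r wge0x.
move: h; rewrite /wge mulf_eq0 invr_eq0 (negPf x0) (negPf p0) /=.
by rewrite dvalM ?invr_neq0 // dvalV // dval_pX; lia.
Qed.

Lemma intring_separated x :
  (forall k, exists2 y, O y & x = p%:R ^+ k * y) -> x = 0.
Proof.
move=> h; apply: (@wge_all_eq0 K v) => k.
by have /wge_pX := h k; apply: wge_le; nia.
Qed.

(** In a Z_p-basis of O_K, convergence is coordinatewise. Since p^k has valuation e k, the
    subsequence u (e k) is the one whose coordinates stabilize modulo p^k. *)
Lemma intring_complete : vcomplete v.
Proof.
move=> u /v0 Ou0 hu; have [X [OX injX surjX]] := integer_basis intring_separated.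
have Ou k : O (u k).
  rewrite -[u k](subrK (u 0%N)); apply: intringD => //; apply/v0.
  exact: (vcauchy_le hu (leq0n k)).
have /choice[C CP] k := surjX _ (Ou (e * k)%N).
have [L LP] : exists L, forall k, exists b, C k - L = p%:R ^+ k *: b.
  have /choice[l lP] i : exists l, forall k, exists b, C k 0 i - l = p%:R ^+ k * b.
    apply: padic_complete => k.
    have [|y Oy yE] := (wge_pX k (u (e * k.+1)%N - u (e * k)%N)).2.
      by apply: vcauchy_le; rewrite // leq_pmul2l.
    have [c cE] := surjX _ Oy; exists (c 0 i).
    move: yE; rewrite -!CP -cE -combB -combZp => /injX/rowP/(_ i).
    by rewrite !mxE.
  exists (\row_i l i) => k; have /choice[b bP] := fun i => lP i k.
  by exists (\row_i b i); apply/rowP => i; rewrite !mxE bP.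
exists (comb X L) => k.
have ek : (k <= e * k)%N by rewrite leq_pmull.
rewrite -[u k](subrK (u (e * k)%N)) -addrA; apply: wgeD.
  by rewrite -opprB; apply/wgeN/vcauchy_le.
rewrite -CP -combB; have [b ->] := LP k; rewrite combZp.
apply: (@wge_le _ _ _ (6%:Z * (e * k)%N%:Z)); first by lia.
by apply/wge_pX; exists (comb X b) => //; apply: comb_intring.
Qed.

End Completeness.

(** * Mixed differences on a cube *)

Section MixedDifferences.
Variables (K : fieldType) (v : dvaluation K).
Implicit Types (cs : seq int) (k : int) (f g : seq bool -> K).

(* f is a function on the cube {0,1}^(size cs), and each of its mixed
   differences over a set T of directions has weight at least
   k + sum of the c_i for i in T. *)
Fixpoint cube_ge cs k f : Prop :=
  if cs is c :: cs' then
    cube_ge cs' k (fun l => f (false :: l)) /\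
    cube_ge cs' (k + c) (fun l => f (true :: l) - f (false :: l))
  else wge v k (f [::]).

Lemma cube_ge_ext cs k f g : f =1 g -> cube_ge cs k f -> cube_ge cs k g.
Proof. by move=> /funext ->. Qed.

Lemma cube_ge_le cs j k f : j <= k -> cube_ge cs k f -> cube_ge cs j f.
Proof.
elim: cs j k f => [|c cs IH] j k f jk /=; first exact: wge_le.
by case=> h0 h1; split; [apply: IH h0 | apply: IH h1; lia].
Qed.

Lemma cube_ge_cst cs k x : wge v k x -> cube_ge cs k (fun=> x).
Proof.
elim: cs k x => [|c cs IH] k x //= hx; split; first exact: IH.
by apply: IH; rewrite subrr wge0x.
Qed.

Lemma cube_geN cs k f : cube_ge cs k f -> cube_ge cs k (fun l => - f l).
Proof.
elim: cs k f => [|c cs IH] k f /=; first exact: wgeN.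
case=> h0 h1; split; first exact: IH.
by apply: cube_ge_ext (IH _ _ h1) => l; rewrite opprB opprK addrC.
Qed.

Lemma cube_geD cs k f g :
  cube_ge cs k f -> cube_ge cs k g -> cube_ge cs k (fun l => f l + g l).
Proof.
elim: cs k f g => [|c cs IH] k f g /=; first exact: wgeD.
case=> f0 f1 [g0 g1]; split; first exact: IH.
by apply: cube_ge_ext (IH _ _ _ f1 g1) => l; rewrite opprD addrACA.
Qed.

Lemma cube_geB cs k f g :
  cube_ge cs k f -> cube_ge cs k g -> cube_ge cs k (fun l => f l - g l).
Proof. by move=> hf hg; apply: cube_geD hf (cube_geN hg). Qed.

Lemma cube_ge_true c cs k f : 0 <= c -> cube_ge (c :: cs) k f ->
  cube_ge cs k (fun l => f (true :: l)).
Proof.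
move=> c0 [h0 h1]; have h1' : cube_ge cs k (fun l => f (true :: l) - f (false :: l)).
  by apply: cube_ge_le h1; rewrite lerDl.
by apply: cube_ge_ext (cube_geD h1' h0) => l; rewrite subrK.
Qed.

(** Leibniz rule for differences: D(fg) = (Df) g_true + f_false (Dg). Nonnegative increments let
    g_true inherit the bound of g_false. *)
Lemma cube_geM cs j k f g : all (>= 0) cs ->
  cube_ge cs j f -> cube_ge cs k g -> cube_ge cs (j + k) (fun l => f l * g l).
Proof.
elim: cs j k f g => [|c cs IH] j k f g; first by move=> _; apply: wgeM.
case/andP=> c0 cs0 hf hg; have g1' := cube_ge_true c0 hg.
case: hf hg => f0 f1 [g0 g1]; split; first exact: IH.
have h1 := IH _ _ _ _ cs0 f1 g1'; have h2 := IH _ _ _ _ cs0 f0 g1.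
rewrite addrAC in h1; rewrite addrA in h2.
by apply: cube_ge_ext (cube_geD h1 h2) => l; ring.
Qed.

Lemma cube_geX cs k f n : all (>= 0) cs -> cube_ge cs k f ->
  cube_ge cs (k * n%:Z) (fun l => f l ^+ n).
Proof.
move=> cs0 hf; elim: n => [|n IH].
  by rewrite mulr0; apply: cube_ge_ext (cube_ge_cst _ (wge_nat v 1)) => l.
have -> : k * n.+1%:Z = k + k * n%:Z by lia.
by apply: cube_ge_ext (cube_geM cs0 hf IH) => l; rewrite exprS.
Qed.

(** The difference of 1/f is -(Df) / (f_false f_true), and the induction covers the inverses on both
    faces. *)
Lemma cube_geV cs f : all (>= 0) cs -> (forall l, vunit v (f l)) ->
  cube_ge cs 0 f -> cube_ge cs 0 (fun l => (f l)^-1).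
Proof.
elim: cs f => [|c cs IH] f; first by move=> _ fu _; apply/vunit_wge/vunitV.
case/andP=> c0 cs0 fu hf; have f1' := cube_ge_true c0 hf.
case: hf => f0 f1; have V0 := IH _ cs0 (fun l => fu (false :: l)) f0.
have V1 := IH _ cs0 (fun l => fu (true :: l)) f1'.
split=> //; have := cube_geM cs0 (cube_geN f1) (cube_geM cs0 V0 V1).
rewrite !addr0; apply: cube_ge_ext => l.
by field; rewrite !(vunit_neq0 (fu _)).
Qed.

Lemma cube_ge_head c cs k x y : wge v k x -> wge v (k + c) (y - x) ->
  cube_ge (c :: cs) k (fun l => if head false l then y else x).
Proof. by move=> hx hy; split=> /=; apply: cube_ge_cst. Qed.

Lemma cube_ge_behead c cs k f :
  cube_ge cs k f -> cube_ge (c :: cs) k (fun l => f (behead l)).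
Proof.
move=> hf; split=> //=.
by apply: cube_ge_ext (cube_ge_cst _ (wge0x v _)) => l; rewrite subrr.
Qed.

Fixpoint cube_diff n f : K :=
  if n is n'.+1 then cube_diff n' (fun l => f (true :: l) - f (false :: l))
  else f [::].

Lemma cube_ge_diff n c k f :
  cube_ge (nseq n c) k f -> wge v (k + c * n%:Z) (cube_diff n f).
Proof.
elim: n k f => [|n IH] k f /=; first by rewrite mulr0 addr0.
by case=> _ /IH; congr (wge v _ _); lia.
Qed.

Lemma cube_diff_ext n f g : (forall l, size l = n -> f l = g l) ->
  cube_diff n f = cube_diff n g.
Proof.
elim: n f g => [|n IH] f g fg /=; first exact: fg.
by apply: IH => l sl; rewrite !fg //= sl.
Qed.

End MixedDifferences.

(** * Forward differences and Newton's formula *)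

Section ForwardDifferences.
Variable R : pzRingType.
Implicit Types s : nat -> R.

Fixpoint fdiff n s m : R :=
  if n is n'.+1 then fdiff n' (fun i => s i.+1 - s i) m else s m.

Lemma fdiffB n s s' m : fdiff n (fun i => s i - s' i) m = fdiff n s m - fdiff n s' m.
Proof.
elim: n s s' => [//|n IH] s s' /=; rewrite -IH; congr fdiff.
by apply/funext => i; rewrite !opprD !opprK addrACA.
Qed.

Lemma newton_forward n s : s n = \sum_(i < n.+1) fdiff i s 0%N *+ 'C(n, i).
Proof.
elim: n s => [|n IH] s; first by rewrite big_ord_recl big_ord0 addr0.
rewrite (IH (fun m => s m.+1)).
have shift i : fdiff i (fun m => s m.+1) 0%N = fdiff i s 0%N + fdiff i.+1 s 0%N.
  by rewrite /= fdiffB addrC subrK.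
under eq_bigr do rewrite shift mulrnDl.
rewrite big_split /= [RHS]big_ord_recl [X in X + _ = _]big_ord_recl !bin0 -addrA.
congr (_ + _); under [RHS]eq_bigr do rewrite lift0 binS mulrnDr.
rewrite big_split /=; congr (_ + _).
by rewrite [RHS]big_ord_recr /= bin_small // mulr0n addr0.
Qed.

End ForwardDifferences.

Lemma cube_diff_count (K : fieldType) n (s : nat -> K) m :
  cube_diff n (fun l => s (m + count id l)%N) = fdiff n s m.
Proof.
elim: n s => [|n IH] s /=; first by rewrite addn0.
by rewrite -IH; congr cube_diff; apply/funext => l; rewrite add0n add1n addnS.
Qed.

(** * The chart domain *)

(** The weight of each monomial is assembled from the hypotheses in context; weights being closed
    numerals, the comparison with the goal is by evaluation. *)
Ltac wge_mono := lazymatch goal with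
  | |- is_true (wge _ _ (_ * _)) => eapply wgeM; [wge_mono | wge_mono]
  | |- is_true (wge _ _ (_ ^+ _)) => eapply wgeX; wge_mono
  | |- _ => eassumption
  end.
Ltac wge_sum := lazymatch goal with
  | |- is_true (wge _ _ (_ + _)) => apply: wgeD; wge_sum
  | |- is_true (wge _ _ (- _)) => apply: wgeN; wge_sum
  | |- _ => eapply wge_le; [ | wge_mono]; exact isT
  end.

Ltac cube_mono := lazymatch goal with
  | |- cube_ge _ _ _ (fun l => @?f l * @?g l) =>
      eapply (@cube_geM _ _ _ _ _ f g); [eassumption | cube_mono | cube_mono]
  | |- cube_ge _ _ _ (fun l => @?f l ^+ ?n) =>
      eapply (@cube_geX _ _ _ _ f n); [eassumption | cube_mono]
  | |- _ => eassumption
  end.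
Ltac cube_sum := lazymatch goal with
  | |- cube_ge _ _ _ (fun l => @?f l + @?g l) =>
      apply (@cube_geD _ _ _ _ f g); cube_sum
  | |- cube_ge _ _ _ (fun l => - @?f l) => apply (@cube_geN _ _ _ _ f); cube_sum
  | |- _ => eapply cube_ge_le; [ | cube_mono]; exact isT
  end.

Section AdditiveChart.
Variables (K : fieldType) (v : dvaluation K) (W : weierstrass K).
Hypothesis ha : [/\ wge v 6 (a1 W), wge v 6 (a2 W), wge v 6 (a3 W),
  wge v 6 (a4 W) & wge v 6 (a6 W)].
Local Notation O := (wge v 0).
Implicit Types P Q R : K * K.

(** With all a_i in m_K these are the chart coordinates of the points of E_0(K), as [E0_chart]
    shows. *)
Definition inU P := [/\ O P.1, O P.2 & chart_eq W P.1 P.2 = 0].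

Let O1 : O 1 := wge_nat v 1.
Let O2 : O 2%:R := wge_nat v 2.
Let O3 : O 3%:R := wge_nat v 3.

Lemma sden_vunit z1 w1 z2 w2 : O z1 -> O w1 -> O z2 -> O w2 ->
  vunit v (sden W z1 w1 z2 w2).
Proof.
case: ha => A1 A2 A3 A4 A6 hz1 hw1 hz2 hw2.
rewrite /sden -!addrA; apply: vunit_1D; rewrite !mulrDr.
wge_sum.
Qed.

Lemma nden_vunit z w : O z -> O w -> vunit v (nden W z w).
Proof.
case: ha => A1 A2 A3 A4 A6 hz hw.
rewrite /nden -!addrA; apply: vunit_1D; wge_sum.
Qed.

Lemma lcub_vunit l : O l -> vunit v (lcub W l).
Proof.
case: ha => A1 A2 A3 A4 A6 hl.
rewrite /lcub -!addrA; apply: vunit_1D; wge_sum.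
Qed.

Lemma slope_O z1 w1 z2 w2 : O z1 -> O w1 -> O z2 -> O w2 ->
  O (slope W z1 w1 z2 w2).
Proof.
move=> hz1 hw1 hz2 hw2; have hD := vunit_wge (vunitV (sden_vunit hz1 hw1 hz2 hw2)).
case: ha => A1 A2 A3 A4 A6; rewrite /slope.
have : O (z1 + z2) by exact: wgeD.
move=> hs; apply: (@wgeM _ _ 0 0) => //; wge_sum.
Qed.

Lemma icpt_O z1 w1 z2 w2 : O z1 -> O w1 -> O z2 -> O w2 ->
  O (icpt W z1 w1 z2 w2).
Proof.
by move=> h1 h2 h3 h4; have hl := slope_O h1 h2 h3 h4; rewrite /icpt; wge_sum.
Qed.

Lemma third_O P Q : inU P -> inU Q -> O (third W P Q).1 /\ O (third W P Q).2.
Proof.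
move=> [hz1 hw1 c1] [hz2 hw2 c2]; rewrite /third /=.
have hl := slope_O hz1 hw1 hz2 hw2; have hn := icpt_O hz1 hw1 hz2 hw2.
have hA := vunit_wge (vunitV (lcub_vunit hl)).
case: ha => A1 A2 A3 A4 A6; rewrite /lsqr.
set z := - _ - _ - _.
suff hz : O z by split=> //; wge_sum.
rewrite /z; apply: wgeB; first by wge_sum.
by apply: (@wgeM _ _ 0 0) => //; wge_sum.
Qed.

Lemma inU_sden P Q : inU P -> inU Q -> sden W P.1 P.2 Q.1 Q.2 != 0.
Proof. by move=> [? ? _] [? ? _]; apply/vunit_neq0/sden_vunit. Qed.

Lemma inU_lcub P Q : inU P -> inU Q -> lcub W (slope W P.1 P.2 Q.1 Q.2) != 0.
Proof. by move=> [? ? _] [? ? _]; apply/vunit_neq0/lcub_vunit/slope_O. Qed.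

Lemma inU_third P Q : inU P -> inU Q -> inU (third W P Q).
Proof.
move=> hP hQ; have [h1 h2] := third_O hP hQ; split=> //.
case: (hP) (hQ) => [_ _ c1] [_ _ c2].
by apply: chart_eq_third => //; [apply: inU_sden | apply: inU_lcub].
Qed.

Lemma inU_nden P : inU P -> nden W P.1 P.2 != 0.
Proof. by case=> ? ? _; apply/vunit_neq0/nden_vunit. Qed.

Lemma inU_neg P : inU P -> inU (cneg W P).
Proof.
move=> hP; have n0 := inU_nden hP; case: hP => hz hw c.
have hV := vunit_wge (vunitV (nden_vunit hz hw)).
split; last exact: chart_eq_neg; rewrite /cneg /=; wge_sum.
Qed.

Lemma inU_add P Q : inU P -> inU Q -> inU (cadd W P Q).
Proof. by move=> hP hQ; apply/inU_neg/inU_third. Qed.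

Lemma inU0 : inU (0, 0).
Proof. by split; rewrite ?wge0x //; apply: chart_eq0. Qed.

Lemma inU_inj P Q : inU P -> inU Q -> P.1 = Q.1 -> P = Q.
Proof.
case: P Q => [z w] [z' w'] [/= hz hw c] [/= hz' hw' c'] e.
rewrite -{}e in hz' c' *; congr pair; apply: chart_eq_inj c c' _.
exact/vunit_neq0/sden_vunit.
Qed.

Lemma cadd_0l P : inU P -> cadd W (0, 0) P = P.
Proof.
move=> hP; case: (hP) => hz hw c; apply: cadd0 => //.
- exact: (inU_sden inU0 hP).
- exact: (inU_lcub inU0 hP).
- exact: (inU_nden (inU_third inU0 hP)).
Qed.

Lemma inU_addC P Q : inU P -> inU Q -> cadd W P Q = cadd W Q P.
Proof.
by move=> hP hQ; apply: caddC; try exact: inU_sden; [case: hP | case: hQ].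
Qed.

Lemma cadd_0r P : inU P -> cadd W P (0, 0) = P.
Proof. by move=> hP; rewrite (inU_addC hP inU0) cadd_0l. Qed.

Lemma inU_w0 P : inU P -> P.2 = 0 -> P = (0, 0).
Proof.
by case: P => z w [_ _ /= c] w0; rewrite w0 in c *; rewrite (chart_eq_w0 c).
Qed.

Lemma chart_add P Q : inU P -> inU Q ->
  chart (cadd W P Q) = pt_add W (chart P) (chart Q).
Proof.
move=> hP hQ; have [w0|w0] := eqVneq P.2 0.
  by rewrite (inU_w0 hP w0) cadd_0l // /chart /= eqxx.
have [w'0|w'0] := eqVneq Q.2 0.
  rewrite (inU_w0 hQ w'0) cadd_0r // [chart (0, 0)]/chart /= eqxx.
  by rewrite /chart (negPf w0).
apply: chart_cadd => //; try by [case: hP | case: hQ].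
- exact: inU_sden.
- exact: inU_lcub.
- exact/inU_nden/inU_third.
Qed.

Lemma chart_inU_inj P Q : inU P -> inU Q -> chart P = chart Q -> P = Q.
Proof. by move=> [_ _ c] [_ _ c']; apply: chart_inj c c'. Qed.

Lemma cadd_neg P : inU P -> cadd W P (cneg W P) = (0, 0).
Proof.
move=> hP; have hN := inU_neg hP.
apply: (chart_inU_inj (inU_add hP hN) inU0).
rewrite chart_add // chart_neg ?inU_nden // [chart (0, 0)]/chart /= eqxx.
rewrite /chart; case: eqP => //= _; rewrite eqxx /=.
by rewrite (_ : _ + a3 W = 0) ?eqxx //; ring.
Qed.

Section CubeClosure.
Variable cs : seq int.
Hypothesis cs0 : all (>= 0) cs.

(** Each a_i has weight 6 but is credited with i only: the formulas become homogeneous, with weights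
    -1, -3, -2 for z, w and the slope, and 0 for every denominator. *)
Let cA1 : cube_ge v cs 1 (fun=> a1 W).
Proof. by case: ha => h *; apply: cube_ge_cst; apply: wge_le h. Qed.
Let cA2 : cube_ge v cs 2 (fun=> a2 W).
Proof. by case: ha => _ h *; apply: cube_ge_cst; apply: wge_le h. Qed.
Let cA3 : cube_ge v cs 3 (fun=> a3 W).
Proof. by case: ha => _ _ h *; apply: cube_ge_cst; apply: wge_le h. Qed.
Let cA4 : cube_ge v cs 4 (fun=> a4 W).
Proof. by case: ha => _ _ _ h *; apply: cube_ge_cst; apply: wge_le h. Qed.
Let cA6 : cube_ge v cs 6 (fun=> a6 W).
Proof. by case: ha => _ _ _ _ h; apply: cube_ge_cst; apply: wge_le h. Qed.
Let cC1 : cube_ge v cs 0 (fun=> 1). Proof. exact: cube_ge_cst. Qed.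
Let cC2 : cube_ge v cs 0 (fun=> 2%:R). Proof. exact: cube_ge_cst. Qed.
Let cC3 : cube_ge v cs 0 (fun=> 3%:R). Proof. exact: cube_ge_cst. Qed.

Lemma cube_ge_sden (z1 w1 z2 w2 : seq bool -> K) :
  cube_ge v cs (-1) z1 -> cube_ge v cs (-3%:Z) w1 -> cube_ge v cs (-3%:Z) w2 ->
  cube_ge v cs 0 (fun l => sden W (z1 l) (w1 l) (z2 l) (w2 l)).
Proof.
move=> hz1 hw1 hw2; rewrite /sden.
have w12 : cube_ge v cs (-3%:Z) (fun l => w1 l + w2 l) by exact: cube_geD.
have ww : cube_ge v cs (-6%:Z) (fun l => w1 l ^+ 2 + w1 l * w2 l + w2 l ^+ 2).
  by cube_sum.
by cube_sum.
Qed.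

Lemma cube_ge_slope (z1 w1 z2 w2 : seq bool -> K) :
  (forall l, vunit v (sden W (z1 l) (w1 l) (z2 l) (w2 l))) ->
  cube_ge v cs (-1) z1 -> cube_ge v cs (-3%:Z) w1 ->
  cube_ge v cs (-1) z2 -> cube_ge v cs (-3%:Z) w2 ->
  cube_ge v cs (-2%:Z) (fun l => slope W (z1 l) (w1 l) (z2 l) (w2 l)).
Proof.
move=> hD hz1 hw1 hz2 hw2; rewrite /slope.
have hV := cube_geV cs0 hD (cube_ge_sden _ hz1 hw1 hw2).
have z12 : cube_ge v cs (-1) (fun l => z1 l + z2 l) by exact: cube_geD.
have hN : cube_ge v cs (-2%:Z) (fun l => z1 l ^+ 2 + z1 l * z2 l + z2 l ^+ 2
    + a1 W * w2 l + a2 W * (z1 l + z2 l) * w2 l + a4 W * w2 l ^+ 2).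
  by cube_sum.
exact: cube_geM cs0 hN hV.
Qed.

Lemma cube_ge_lcub (l : seq bool -> K) :
  cube_ge v cs (-2%:Z) l -> cube_ge v cs 0 (fun x => lcub W (l x)).
Proof. by move=> hl; rewrite /lcub; cube_sum. Qed.

Lemma cube_ge_lsqr (l n : seq bool -> K) :
  cube_ge v cs (-2%:Z) l -> cube_ge v cs (-3%:Z) n ->
  cube_ge v cs (-1) (fun x => lsqr W (l x) (n x)).
Proof. by move=> hl hn; rewrite /lsqr; cube_sum. Qed.

Lemma cube_ge_nden (z w : seq bool -> K) :
  cube_ge v cs (-1) z -> cube_ge v cs (-3%:Z) w ->
  cube_ge v cs 0 (fun x => nden W (z x) (w x)).
Proof. by move=> hz hw; rewrite /nden; cube_sum. Qed.

Lemma cube_ge_third (P Q : seq bool -> K * K) :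
  (forall l, inU (P l)) -> (forall l, inU (Q l)) ->
  cube_ge v cs (-1) (fun l => (P l).1) -> cube_ge v cs (-3%:Z) (fun l => (P l).2) ->
  cube_ge v cs (-1) (fun l => (Q l).1) -> cube_ge v cs (-3%:Z) (fun l => (Q l).2) ->
  cube_ge v cs (-1) (fun l => (third W (P l) (Q l)).1) /\
  cube_ge v cs (-3%:Z) (fun l => (third W (P l) (Q l)).2).
Proof.
move=> UP UQ hz1 hw1 hz2 hw2.
have hD x : vunit v (sden W (P x).1 (P x).2 (Q x).1 (Q x).2).
  by case: (UP x) (UQ x) => ? ? _ [? ? _]; apply: sden_vunit.
have hl := cube_ge_slope hD hz1 hw1 hz2 hw2.
have hA x : vunit v (lcub W (slope W (P x).1 (P x).2 (Q x).1 (Q x).2)).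
  by case: (UP x) (UQ x) => ? ? _ [? ? _]; apply/lcub_vunit/slope_O.
have {}hA := cube_geV cs0 hA (cube_ge_lcub hl).
have hn : cube_ge v cs (-3%:Z) (fun x => icpt W (P x).1 (P x).2 (Q x).1 (Q x).2).
  exact: cube_geB hw1 (cube_geM cs0 hl hz1).
have h1 := cube_geB (cube_geB (cube_geN hz1) hz2)
  (cube_geM cs0 (cube_ge_lsqr hl hn) hA).
split; first exact: h1.
exact: cube_geD (cube_geM cs0 hl h1) hn.
Qed.

Lemma cube_ge_cadd (P Q : seq bool -> K * K) :
  (forall l, inU (P l)) -> (forall l, inU (Q l)) ->
  cube_ge v cs (-1) (fun l => (P l).1) -> cube_ge v cs (-3%:Z) (fun l => (P l).2) ->
  cube_ge v cs (-1) (fun l => (Q l).1) -> cube_ge v cs (-3%:Z) (fun l => (Q l).2) ->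
  cube_ge v cs (-1) (fun l => (cadd W (P l) (Q l)).1) /\
  cube_ge v cs (-3%:Z) (fun l => (cadd W (P l) (Q l)).2).
Proof.
move=> UP UQ hz1 hw1 hz2 hw2.
have [h1 h2] := cube_ge_third UP UQ hz1 hw1 hz2 hw2.
have hN x : vunit v (nden W (third W (P x) (Q x)).1 (third W (P x) (Q x)).2).
  by case: (inU_third (UP x) (UQ x)) => ? ? _; apply: nden_vunit.
have {}hN := cube_geV cs0 hN (cube_ge_nden h1 h2).
split; first exact: cube_geN (cube_geM cs0 h1 hN).
exact: cube_geN (cube_geM cs0 h2 hN).
Qed.

End CubeClosure.

End AdditiveChart.

(** * Estimates for addition and for multiplication by p *)

Section AdditiveGroup.
Variables (K : fieldType) (v : dvaluation K) (W : weierstrass K).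
Hypothesis ha : [/\ wge v 6 (a1 W), wge v 6 (a2 W), wge v 6 (a3 W),
  wge v 6 (a4 W) & wge v 6 (a6 W)].
Local Notation O := (wge v 0).
Local Notation inU := (inU v W).
Local Notation add := (cadd W).
Local Notation neg := (cneg W).
Implicit Types P Q R : K * K.

Lemma wge_dval (x : K) k : k <= 6%:Z * v x -> wge v k x.
Proof. by rewrite /wge => ->; rewrite orbT. Qed.

Lemma wge6 (x : K) : wge v 1 x -> wge v 6 x.
Proof. by move=> h; apply: (@wge_ceil _ _ 1). Qed.

Lemma wge_divr k (x y : K) : y != 0 -> wge v (k + 6%:Z * v y) x ->
  wge v k (x / y).
Proof.
move=> y0; have [->|x0] := eqVneq x 0; first by rewrite mul0r !wge0x.
rewrite /wge mulf_eq0 invr_eq0 (negPf x0) (negPf y0) /= dvalM ?invr_neq0 //.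
by rewrite dvalV //; lia.
Qed.

Lemma inU_w_sub P Q : inU P -> inU Q ->
  exists2 l, O l & Q.2 - P.2 = l * (Q.1 - P.1).
Proof.
move=> hP hQ; have D0 := inU_sden ha hP hQ.
case: hP hQ => hz hw c [hz' hw' c'].
exists (slope W P.1 P.2 Q.1 Q.2); first exact: slope_O.
by rewrite slope_secant.
Qed.

Lemma mixed_difference P P' Q Q' : inU P -> inU P' -> inU Q -> inU Q' ->
  exists2 r, wge v 6 r &
    (add P' Q').1 - (add P' Q).1 - (add P Q').1 + (add P Q).1
    = r * (P'.1 - P.1) * (Q'.1 - Q.1).
Proof.
move=> hP hP' hQ hQ'.
have [e|d0] := eqVneq (P'.1 - P.1) 0.
  have -> : P' = P by apply: (inU_inj ha) => //; apply/eqP; rewrite -subr_eq0 e.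
  by exists 0; rewrite ?wge0x //; ring.
have [e|d'0] := eqVneq (Q'.1 - Q.1) 0.
  have -> : Q' = Q by apply: (inU_inj ha) => //; apply/eqP; rewrite -subr_eq0 e.
  by exists 0; rewrite ?wge0x //; ring.
set d := P'.1 - P.1 in d0 *; set d' := Q'.1 - Q.1 in d'0 *.
(* The extra 1 offsets the weight -1 of z. The mixed difference then has weight -1 + c + c' = 6 v(d
   d') + 1, so its quotient by d d' has positive weight, which rounds up to 6. *)
pose c := 6%:Z * v d + 1; pose c' := 6%:Z * v d' + 1.
have dO : 0 <= 6%:Z * v d.
  have : O d by case: hP hP' => h _ _ [h' _ _]; apply: wgeB.
  by rewrite /wge (negPf d0).
have d'O : 0 <= 6%:Z * v d'.
  have : O d' by case: hQ hQ' => h _ _ [h' _ _]; apply: wgeB.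
  by rewrite /wge (negPf d'0).
have cs0 : all (>= 0) [:: c; c'] by rewrite /= /c /c'; lia.
pose F (l : seq bool) := if head false l then P' else P.
pose G (l : seq bool) := if head false (behead l) then Q' else Q.
have UF l : inU (F l) by rewrite /F; case: head.
have UG l : inU (G l) by rewrite /G; case: head.
have F1 : cube_ge v [:: c; c'] (-1) (fun l => (F l).1).
  have -> : (fun l => (F l).1) = (fun l => if head false l then P'.1 else P.1).
    by apply/funext => l; rewrite /F; case: head.
  apply: cube_ge_head; first by case: hP => h _ _; apply: wge_le h.
  by apply: (wge_dval (x := d)); rewrite /c; lia.
have F2 : cube_ge v [:: c; c'] (-3%:Z) (fun l => (F l).2).
  have -> : (fun l => (F l).2) = (fun l => if head false l then P'.2 else P.2).
    by apply/funext => l; rewrite /F; case: head.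
  apply: cube_ge_head; first by case: hP => _ h _; apply: wge_le h.
  have [l lO ->] := inU_w_sub hP hP'.
  apply: (@wge_le _ _ _ (0 + 6%:Z * v d)); first by rewrite /c; lia.
  by apply: wgeM => //; apply: wge_dval.
have G1 : cube_ge v [:: c; c'] (-1) (fun l => (G l).1).
  pose f m := if head false m then Q'.1 else Q.1.
  have -> : (fun l => (G l).1) = (fun l => f (behead l)).
    by apply/funext => l; rewrite /G /f; case: head.
  apply: cube_ge_behead; apply: cube_ge_head.
    by case: hQ => h _ _; apply: wge_le h.
  by apply: (wge_dval (x := d')); rewrite /c'; lia.
have G2 : cube_ge v [:: c; c'] (-3%:Z) (fun l => (G l).2).
  pose f m := if head false m then Q'.2 else Q.2.
  have -> : (fun l => (G l).2) = (fun l => f (behead l)).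
    by apply/funext => l; rewrite /G /f; case: head.
  apply: cube_ge_behead; apply: cube_ge_head.
    by case: hQ => _ h _; apply: wge_le h.
  have [l lO ->] := inU_w_sub hQ hQ'.
  apply: (@wge_le _ _ _ (0 + 6%:Z * v d')); first by rewrite /c'; lia.
  by apply: wgeM => //; apply: wge_dval.
have [[_ [_ h]] _] := cube_ge_cadd ha cs0 UF UG F1 F2 G1 G2.
pose x := (add P' Q').1 - (add P Q').1 - ((add P' Q).1 - (add P Q).1).
have {}h : wge v (-1 + c + c') x := h.
exists (x / (d * d')); last by rewrite -mulrA divfK ?mulf_neq0 // /x; ring.
apply/wge6/wge_divr; first by rewrite mulf_neq0.
by apply: wge_le h; rewrite dvalM // /c /c'; lia.
Qed.

Lemma add_z P Q : inU P -> inU Q ->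
  exists2 r, wge v 6 r & (add P Q).1 = P.1 + Q.1 + r * P.1 * Q.1.
Proof.
move=> hP hQ; have [r r6] := mixed_difference (inU0 v W) hP (inU0 v W) hQ.
rewrite (cadd_0r ha (inU0 v W)) (cadd_0l ha hQ) (cadd_0r ha hP) /=.
by rewrite !subr0 addr0 => e; exists r => //; rewrite -e; ring.
Qed.

Lemma add_z_sub P P' Q : inU P -> inU P' -> inU Q ->
  exists2 r, wge v 6 r & (add P' Q).1 - (add P Q).1 = (P'.1 - P.1) * (1 + r).
Proof.
move=> hP hP' hQ; have [r r6] := mixed_difference hP hP' (inU0 v W) hQ.
rewrite !(cadd_0r ha) // subr0 => e; exists (r * Q.1).
  by case: hQ => h _ _; have := wgeM r6 h; rewrite addr0.
by rewrite mulrDr mulr1 mulrCA mulrA -e; ring.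
Qed.

Fixpoint cmuln n P : K * K := if n is n'.+1 then add P (cmuln n' P) else (0, 0).

Lemma inU_muln n P : inU P -> inU (cmuln n P).
Proof. by move=> hP; elim: n => [|n IH]; [apply: inU0 | apply: inU_add]. Qed.

(** Summing the copies of P selected by a vertex makes z(mP) a function on the cube, m being the
    number of selected directions. Forward differences of z(mP) thus become mixed differences, to
    which the cube estimates apply. *)
Fixpoint csum n P (l : seq bool) : K * K :=
  if n is n'.+1 then add (if head false l then P else (0, 0)) (csum n' P (behead l))
  else (0, 0).

Lemma csum_count n P l : inU P -> size l = n -> csum n P l = cmuln (count id l) P.
Proof.
move=> hP; elim: n l => [|n IH] [|b l] //= [sl]; rewrite IH //.
by case: b; rewrite //= add0n (cadd_0l ha) //; apply: inU_muln.
Qed.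

Lemma inU_csum n P l : inU P -> inU (csum n P l).
Proof.
move=> hP; elim: n l => [|n IH] l; first exact: inU0.
by apply: (inU_add ha) => //; case: head => //; apply: inU0.
Qed.

Lemma cube_ge_csum n P : inU P -> P.1 != 0 ->
  let cs := nseq n (6%:Z * v P.1 + 1) in
  cube_ge v cs (-1) (fun l => (csum n P l).1) /\
  cube_ge v cs (-3%:Z) (fun l => (csum n P l).2).
Proof.
move=> hP z0 cs; have zO : 0 <= 6%:Z * v P.1.
  by case: (hP) => h _ _; move: h; rewrite /wge (negPf z0).
have : all (>= 0) cs by rewrite all_nseq; apply/orP; right; lia.
rewrite {}/cs; elim: n => [|n IH] cs0; first by split; apply: wge0x.
have [IH1 IH2] := IH (proj2 (andP cs0)).
pose F (l : seq bool) := if head false l then P else (0, 0).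
have UF l : inU (F l) by rewrite /F; case: head => //; apply: inU0.
apply: (cube_ge_cadd ha cs0 UF (Q := fun l => csum n P (behead l))).
- by move=> l; apply: inU_csum.
- have -> : (fun l => (F l).1) = (fun l => if head false l then P.1 else 0).
    by apply/funext => l; rewrite /F; case: head.
  by apply: cube_ge_head; rewrite ?wge0x // subr0; apply: wge_dval; lia.
- have -> : (fun l => (F l).2) = (fun l => if head false l then P.2 else 0).
    by apply/funext => l; rewrite /F; case: head.
  apply: cube_ge_head; rewrite ?wge0x //.
  have [l lO] := inU_w_sub (inU0 v W) hP; rewrite !subr0 => ->.
  apply: (@wge_le _ _ _ (0 + 6%:Z * v P.1)); first by lia.
  by apply: wgeM => //; apply: wge_dval.
- exact: (cube_ge_behead _ IH1).
- exact: (cube_ge_behead _ IH2).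
Qed.

Lemma fdiff_muln n P : inU P -> P.1 != 0 ->
  wge v (-1 + (6%:Z * v P.1 + 1) * n%:Z) (fdiff n (fun m => (cmuln m P).1) 0%N).
Proof.
move=> hP z0; rewrite -cube_diff_count.
rewrite (_ : cube_diff _ _ = cube_diff n (fun l => (csum n P l).1)).
  exact/cube_ge_diff/(cube_ge_csum n hP z0).1.
by apply: cube_diff_ext => l sl; rewrite add0n csum_count.
Qed.

(* The forward differences of m |-> z(mP) turn z(pP) into
   sum_i C(p, i) Delta^i: for 1 < i < p the binomial is divisible by p, and
   Delta^p has weight at least p - 1 > 6 e. *)
Lemma muln_prime p e P : prime p -> p%:R != 0 :> K -> v p%:R = e%:Z ->
  (6 * e < p - 1)%N -> inU P ->
  exists2 r, wge v 6 r & (cmuln p P).1 = p%:R * P.1 * (1 + r * P.1).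
Proof.
move=> hp p0 vp hpe hP; have p1 := prime_gt1 hp.
have [z0|z0] := eqVneq P.1 0.
  have -> : P = (0, 0) by apply: (inU_inj ha) => //; apply: inU0.
  exists 0; rewrite ?wge0x // !(mulr0, mul0r).
  suff -> : cmuln p (0, 0) = (0, 0) by [].
  by elim: p {hp p0 vp hpe p1} => //= p ->; apply: (cadd_0l ha); apply: inU0.
have zO : 0 <= 6%:Z * v P.1.
  by case: (hP) => h _ _; move: h; rewrite /wge (negPf z0).
have wp : wge v (6%:Z * e%:Z) p%:R by apply: wge_dval; rewrite vp.
pose s m := (cmuln m P).1.
set x := \sum_(i < p.-1) fdiff i.+2 s 0%N *+ 'C(p, i.+2).
have sE : s p = p%:R * P.1 + x.
  have pS : p.+1 = p.-1.+2 by lia.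
  have s0 : s 0%N = 0 by [].
  have s1 : s 1%N = P.1 := congr1 fst (cadd_0r ha hP).
  rewrite newton_forward pS !big_ord_recl /= s1 s0 mul0rn add0r bin1.
  rewrite subr0 -[P.1 *+ p]mulr_natl.
  by congr (_ + _); apply: eq_bigr => i _; rewrite add0n.
(* One more than the weight of p z(P)^2, so that the quotient r has positive weight and lies in
   m_K. *)
have hx : wge v (6%:Z * e%:Z + 12%:Z * v P.1 + 1) x.
  apply: (big_ind (fun x => wge v _ x)); [exact: wge0x | exact: wgeD |].
  move=> i _; have := fdiff_muln i.+2 hP z0; rewrite -/s => hi.
  have [ip|ip] := eqVneq i.+2 p.
    rewrite [X in _ *+ X](_ : _ = 1%N) ?mulr1n; last by rewrite -[X in 'C(X, _)]ip binn.
    apply: wge_le hi.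
    have ep : (6 * e + 1 <= i.+1)%N by move: hpe ip; lia.
    nia.
  have ltip : (i.+2 < p)%N.
    by have := ltn_ord i; move: ip p1; lia.
  have /dvdnP[m ->] := prime_dvd_bin (k := i.+2) hp ltip.
  rewrite -mulr_natl natrM -mulrA mulrCA.
  have h0 := wge_nat v m.
  have h1 := wgeM wp (wgeM h0 hi); apply: wge_le h1.
  nia.
exists (x / (p%:R * P.1 ^+ 2)).
  apply/wge6/wge_divr; first by rewrite mulf_neq0 ?expf_neq0.
  rewrite expr2 !dvalM ?mulf_neq0 // vp; apply: wge_le hx; lia.
by rewrite -/(s p) sE; field; rewrite p0 z0.
Qed.

End AdditiveGroup.

(** * Associativity *)

Section Associativity.
Variables (K : fieldType) (v : dvaluation K) (W : weierstrass K).
Hypothesis ha : [/\ wge v 6 (a1 W), wge v 6 (a2 W), wge v 6 (a3 W),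
  wge v 6 (a4 W) & wge v 6 (a6 W)].
Hypothesis complete : vcomplete v.
Local Notation O := (wge v 0).
Local Notation inU := (inU v W).
Local Notation add := (cadd W).
Local Notation neg := (cneg W).
Implicit Types P Q R : K * K.

(** The chart equation says that w is a fixed point of w |-> z^3 + a1 z w + ... + a6 w^3, a
    contraction since each term in w carries some a_i. With [inU_inj], z is a bijection from [inU]
    onto O_K. *)
Lemma inU_lift z : O z -> exists2 P, inU P & P.1 = z.
Proof.
case: ha => A1 A2 A3 A4 A6 hz.
pose g w := chart_eq W z w + w.
have [w Ow|x y Ox Oy|w Ow gw] := @vcomplete_fixpoint K v g complete.
- rewrite /g /chart_eq; apply: wgeD => //; wge_sum.
- exists (a1 W * z + a2 W * z ^+ 2 + a3 W * (x + y) + a4 W * z * (x + y)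
    + a6 W * (x ^+ 2 + x * y + y ^+ 2)); last by rewrite /g /chart_eq; ring.
  have h1 : O (x + y) by apply: wgeD.
  have h2 : O (x ^+ 2 + x * y + y ^+ 2) by wge_sum.
  wge_sum.
- exists (z, w) => //; split=> //=.
  by apply: (addIr w); rewrite add0r.
Qed.

Lemma chart_affine P : inU P -> P.1 != 0 ->
  chart P = Affine (P.1 / P.2) (- P.2^-1) /\ P.2 != 0.
Proof.
move=> hP z0; rewrite /chart; case: eqVneq => // w0.
by move: z0; rewrite (inU_w0 hP w0) eqxx.
Qed.

Lemma chart_eq_xcoord P Q : inU P -> inU Q -> P.1 != 0 -> Q.1 != 0 ->
  xcoord (chart P) = xcoord (chart Q) -> P = Q \/ P = neg Q.
Proof.
move=> hP hQ zP zQ; have hN := inU_neg ha hQ.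
have cP := chart_on_curve (let: And3 _ _ c := hP in c).
have cQ := chart_on_curve (let: And3 _ _ c := hQ in c).
have eN := chart_neg (inU_nden ha hQ).
have [eP wP] := chart_affine hP zP; have [eQ wQ] := chart_affine hQ zQ.
move: cP cQ eN; rewrite eP eQ /= => cP cQ eN ex; rewrite ex in cP eP.
set x := Q.1 / Q.2 in cP cQ eN eP eQ; set y := - P.2^-1 in cP eP.
set y' := - Q.2^-1 in cQ eN eQ.
have : (y - y') * (y - (- y' - a1 W * x - a3 W)) = 0.
  apply/eqP; rewrite -(subr_eq0 _ 0) subr0; apply/eqP.
  transitivity ((y ^+ 2 + a1 W * x * y + a3 W * y)
    - (y' ^+ 2 + a1 W * x * y' + a3 W * y')); first by ring.
  by rewrite cP cQ subrr.
move/eqP; rewrite mulf_eq0 !subr_eq0 => /orP[]/eqP ey; [left|right].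
  by apply: (chart_inU_inj hP hQ); rewrite eP eQ ey.
by apply: (chart_inU_inj hP hN); rewrite eP eN ey.
Qed.

(** The values z + t^(N+k), with t of valuation 1, are distinct and close to z; one more of them
    than there are bad values suffices. *)
Lemma inU_avoid (bad : seq K) z N : O z ->
  exists P, [/\ inU P, P.1 \notin bad & wge v (6%:Z * N%:Z) (P.1 - z)].
Proof.
move=> hz; have [t t0 vt] := dval_surj v.
pose s := [seq z + t ^+ (N + k) | k <- iota 0 (size bad).+1].
have vtk k : v (t ^+ k) = k%:Z.
  elim: k => [|k IH]; first by rewrite dval1.
  by rewrite exprS dvalM ?expf_neq0 // vt IH; lia.
have us : uniq s.
  rewrite map_inj_uniq ?iota_uniq // => i j /addrI/(congr1 v).
  by rewrite !vtk => -[] /addnI.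
have /hasP[x xs xb] : has (fun x => x \notin bad) s.
  rewrite has_predC; apply/negP => /allP h.
  by have := uniq_leq_size us h; rewrite size_map size_iota ltnn.
have /mapP[k _ xE] := xs.
have hx : wge v (6%:Z * N%:Z) (x - z).
  by rewrite xE addrAC subrr add0r; apply: wge_dval; rewrite vtk; lia.
have Ox : O x by rewrite -[x](subrK z); apply: wgeD hz; apply: wge_le hx; lia.
by have [P hP Px] := inU_lift Ox; exists P; rewrite Px.
Qed.

(** A translation multiplies differences of z by the unit 1 + r. *)
Lemma add_injl P P' Q : inU P -> inU P' -> inU Q ->
  (add P Q).1 = (add P' Q).1 -> P.1 = P'.1.
Proof.
move=> hP hP' hQ e; have [r r6] := add_z_sub ha hP hP' hQ.
rewrite e subrr => /esym/eqP; rewrite mulf_eq0 subr_eq0 => /orP[/eqP//|].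
by rewrite (negPf (vunit_neq0 (vunit_1D (wge_le _ r6)))).
Qed.

Lemma add_close P P' Q Q' k : inU P -> inU P' -> inU Q -> inU Q' ->
  wge v k (P'.1 - P.1) -> wge v k (Q'.1 - Q.1) ->
  wge v k ((add P' Q').1 - (add P Q).1).
Proof.
move=> hP hP' hQ hQ' dP dQ.
have [r r6 e1] := add_z_sub ha hP hP' hQ'.
have [r' r'6 e2] := add_z_sub ha hQ hQ' hP.
rewrite -(subrK (add P Q').1 (add P' Q').1) -addrA e1.
rewrite (inU_addC ha hP hQ) (inU_addC ha hP hQ') e2.
have u x : wge v 6 x -> O (1 + x).
  by move=> h; apply: wgeD (wge_nat v 1) (wge_le _ h).
have := wgeM dP (u _ r6); have := wgeM dQ (u _ r'6); rewrite !addr0.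
by move=> h1 h2; apply: wgeD.
Qed.

(** Points other than the origin share their abscissa only if they are equal or opposite, so
    excluding z(B) and z(-B) as values of z(A) separates the abscissas. The same exclusions keep the
    inner sums away from infinity. *)
Lemma add_assoc_generic P Q R : inU P -> inU Q -> inU R ->
  P.1 \notin [:: 0; Q.1; (neg Q).1; R.1; (neg R).1; (add Q R).1; (neg (add Q R)).1] ->
  Q.1 \notin [:: 0; R.1; (neg R).1] -> R.1 != 0 ->
  (add P Q).1 \notin [:: R.1; (neg R).1] ->
  add (add P Q) R = add P (add Q R).
Proof.
move=> hP hQ hR; rewrite !inE !negb_or.
move=> /and5P[P0 PQ PnQ PR /and3P[PnR PQR PnQR]] /and3P[Q0 QR QnR] R0 /andP[PQR' PQnR].
have ne (A B : K * K) : A.1 != B.1 -> A <> B by move=> /eqP h e; apply: h; rewrite e.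
have hPQ := inU_add ha hP hQ; have hQR := inU_add ha hQ hR.
have xne (A B : K * K) : inU A -> inU B -> A.1 != 0 -> B.1 != 0 -> A.1 != B.1 ->
    A.1 != (neg B).1 -> xcoord (chart A) != xcoord (chart B).
  move=> hA hB A0 B0 /ne h1 /ne h2; apply/eqP => /(chart_eq_xcoord hA hB A0 B0).
  by case.
have add_n0 (A B : K * K) : inU A -> inU B -> A.1 != (neg B).1 -> (add A B).1 != 0.
  move=> hA hB; apply: contraNneq => e.
  have hN := inU_neg ha hB.
  apply/eqP; apply: (add_injl hA hN hB); rewrite e.
  by rewrite (inU_addC ha hN hB) (cadd_neg ha).
apply: (chart_inU_inj (inU_add ha hPQ hR) (inU_add ha hP hQR)).
rewrite !(chart_add ha) //.
have [eP _] := chart_affine hP P0; have [eQ _] := chart_affine hQ Q0.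
have [eR _] := chart_affine hR R0.
have cv A : inU A -> on_curve W (chart A) by case=> _ _; apply: chart_on_curve.
have := cv _ hP; have := cv _ hQ; have := cv _ hR.
have := xne _ _ hP hQ P0 Q0 PQ PnQ; have := xne _ _ hQ hR Q0 R0 QR QnR.
have := xne _ _ hP hR P0 R0 PR PnR.
have := xne _ _ hPQ hR (add_n0 _ _ hP hQ PnQ) R0 PQR' PQnR.
have := xne _ _ hP hQR P0 (add_n0 _ _ hQ hR QnR) PQR PnQR.
rewrite !(chart_add ha) // eP eQ eR => h1 h2 h3 h4 h5 h6 h7 h8.
exact: pt_add_assoc_generic.
Qed.

(* The generic case holds on a dense set of triples, and both sides are
   Lipschitz in the z-coordinates. *)
Lemma add_assoc P Q R : inU P -> inU Q -> inU R ->
  add (add P Q) R = add P (add Q R).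
Proof.
move=> hP hQ hR; have hPQ := inU_add ha hP hQ; have hQR := inU_add ha hQ hR.
apply: (inU_inj ha (inU_add ha hPQ hR) (inU_add ha hP hQR)).
apply/eqP; rewrite -subr_eq0; apply/eqP/(wge_all_eq0 (v := v)) => N.
have [R' [hR' R0 dR]] := inU_avoid [:: 0] N (let: And3 h _ _ := hR in h).
have [Q' [hQ' Q0 dQ]] := inU_avoid [:: 0; R'.1; (neg R').1] N
  (let: And3 h _ _ := hQ in h).
(* By cancellation at most one P1 has z(P1 + Q') = c, so a condition on the sum amounts to one more
   value for z(P') to avoid; if there is none, 0 is a harmless default. *)
have bad c : exists b, forall P1, inU P1 -> (add P1 Q').1 = c -> P1.1 = b.
  have [[P1 h1 e1]|no] := pselect (exists2 P1, inU P1 & (add P1 Q').1 = c).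
    by exists P1.1 => P2 h2 e2; apply: (add_injl h2 h1 hQ'); rewrite e2.
  by exists 0 => P1 h1 e1; case: no; exists P1.
have [b1 b1P] := bad R'.1; have [b2 b2P] := bad (neg R').1.
have [P' [hP' P0 dP]] := inU_avoid [:: b1, b2 & [:: 0; Q'.1; (neg Q').1; R'.1;
  (neg R').1; (add Q' R').1; (neg (add Q' R')).1]] N (let: And3 h _ _ := hP in h).
move: P0; rewrite in_cons negb_or => /andP[P1 P0].
move: P0; rewrite in_cons negb_or => /andP[P2 P0].
have e : add (add P' Q') R' = add P' (add Q' R').
  apply: add_assoc_generic => //; first by move: R0; rewrite inE.
  rewrite !inE negb_or; apply/andP; split.
    by apply: contraNneq P1 => /(b1P _ hP') ->.
  by apply: contraNneq P2 => /(b2P _ hP') ->.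
have hPQ' := inU_add ha hP' hQ'; have hQR' := inU_add ha hQ' hR'.
have h1 := add_close hPQ hPQ' hR hR' (add_close hP hP' hQ hQ' dP dQ) dR.
have h2 := add_close hP hP' hQR hQR' dP (add_close hQ hQ' hR hR' dQ dR).
have := wgeB h2 h1; rewrite e; congr (wge _ _ _); ring.
Qed.

End Associativity.

(** * Logarithm and exponential *)

Section Logarithm.
Variables (K : fieldType) (v : dvaluation K) (W : weierstrass K).
Hypothesis ha : [/\ wge v 6 (a1 W), wge v 6 (a2 W), wge v 6 (a3 W),
  wge v 6 (a4 W) & wge v 6 (a6 W)].
Hypothesis complete : vcomplete v.
Variables (p e : nat).
Hypotheses (hp : prime p) (p0 : p%:R != 0 :> K) (vp : v p%:R = e%:Z)
  (e0 : (0 < e)%N) (hpe : (6 * e < p - 1)%N).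
Local Notation O := (wge v 0).
Local Notation inU := (inU v W).
Local Notation add := (cadd W).
Local Notation neg := (cneg W).
Local Notation muln := (cmuln W).
Implicit Types P Q R : K * K.

Lemma muln_add n P Q : inU P -> inU Q -> muln n (add P Q) = add (muln n P) (muln n Q).
Proof.
move=> hP hQ; elim: n => [|n IH] /=; first by rewrite (cadd_0l ha) //; apply: inU0.
have hmP := inU_muln ha n hP; have hmQ := inU_muln ha n hQ.
have assoc := add_assoc ha complete.
have hA A B : inU A -> inU B -> inU (add A B) by apply: inU_add.
rewrite IH (assoc P Q _ hP hQ (hA _ _ hmP hmQ)).
rewrite (assoc P _ _ hP hmP (hA _ _ hQ hmQ)); congr cadd.
by rewrite -(assoc _ _ _ hQ hmP hmQ) (inU_addC ha hQ hmP) assoc.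
Qed.

Definition ppow k P := iter k (muln p) P.

Lemma inU_ppow k P : inU P -> inU (ppow k P).
Proof. by move=> hP; elim: k => [|k IH] //=; apply: inU_muln. Qed.

Lemma ppow_add k P Q : inU P -> inU Q -> ppow k (add P Q) = add (ppow k P) (ppow k Q).
Proof.
by move=> hP hQ; elim: k => [|k IH] //=; rewrite IH muln_add //; apply: inU_ppow.
Qed.

Lemma wge_exp_prime k : wge v (6%:Z * (e * k)%N%:Z) (p%:R ^+ k).
Proof.
elim: k => [|k IH]; first by rewrite muln0; apply: wge_nat 1.
have wp : wge v (6%:Z * e%:Z) p%:R by apply: wge_dval; rewrite vp.
by rewrite exprS; apply: wge_le (wgeM wp IH); lia.
Qed.

(* log P = lim z(p^k P) / p^k, written as z(P) times a limit of 1-units. *)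
Lemma log_quotient P : inU P -> exists G,
  wge v 6 (G - 1) /\ exists g, vlim v g G /\
    forall k, (ppow k P).1 = p%:R ^+ k * (P.1 * g k) /\ O (g k).
Proof.
move=> hP.
have /choice[r rP] k : exists r, wge v 6 r /\
    (ppow k.+1 P).1 = p%:R * (ppow k P).1 * (1 + r * (ppow k P).1).
  have [r r6 rE] := muln_prime ha hp p0 vp hpe (inU_ppow k hP).
  by exists r.
(* The quotient z(p^k P) / (p^k z(P)), written as a product of 1-units so that it makes sense at the
   origin too. *)
pose g := fix g k := if k is k'.+1 then g k' * (1 + r k' * (ppow k' P).1) else 1.
have gO k : O (g k).
  elim: k => [|k IH] /=; first exact: wge_nat 1.
  have [h _ _] := inU_ppow k hP; have [r6 _] := rP k.
  rewrite -[0]addr0; apply: wgeM => //; apply: wgeD (wge_nat v 1) _.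
  by apply: wge_le (wgeM r6 h).
have gE k : (ppow k P).1 = p%:R ^+ k * (P.1 * g k).
  elim: k => [|k IH]; first by rewrite mul1r mulr1.
  by have [_ ->] := rP k; rewrite {1}IH exprS /=; ring.
have zk k : wge v (6%:Z * (e * k)%N%:Z) (ppow k P).1.
  rewrite gE -[X in wge v X _]addr0; apply: wgeM; first exact: wge_exp_prime.
  by rewrite -[0]addr0; apply: wgeM => //; case: hP.
(* The factor r in m_K improves the rate from k to k + 1; at k = 0 this makes the limit G a
   1-unit. *)
have gC k : wge v (6%:Z * k.+1%:Z) (g k.+1 - g k).
  have -> : g k.+1 - g k = g k * (r k * (ppow k P).1) by rewrite /=; ring.
  have [r6 _] := rP k; apply: wge_le (wgeM (gO k) (wgeM r6 (zk k))).
  by have := leq_pmull k e0; lia.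
have [|G GP] := complete (gO 0%N).
  by move=> k; apply: wge_le (gC k); lia.
exists G; split; last by exists g; split=> // k; split.
have -> : G - 1 = (g 1%N - g 0%N) - (g 1%N - G) by rewrite /=; ring.
by apply: wgeB; [exact: (gC 0%N) | exact: (GP 1%N)].
Qed.

(** For additivity, the cross term of [add_z] at p^k P and p^k Q is divisible by p^(2k), hence still
    tends to 0 after division by p^k. *)
Lemma log_exists : exists L : K * K -> K,
  [/\ forall P, inU P -> exists2 r, wge v 6 r & L P = P.1 * (1 + r) &
      forall P Q, inU P -> inU Q -> L (add P Q) = L P + L Q].
Proof.
have /choice[G GP] P : exists G, inU P ->
    wge v 6 (G - 1) /\ exists g, vlim v g G /\
    forall k, (ppow k P).1 = p%:R ^+ k * (P.1 * g k) /\ O (g k).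
  have [hP|nP] := pselect (inU P); last by exists 0.
  by have [G h] := log_quotient hP; exists G.
exists (fun P => P.1 * G P); split=> [P hP|P Q hP hQ].
  by have [h _] := GP P hP; exists (G P - 1); rewrite // addrC subrK.
have hPQ := inU_add ha hP hQ.
have [_ [g [gG gE]]] := GP _ hPQ; have [_ [gP [gPG gPE]]] := GP _ hP.
have [_ [gQ [gQG gQE]]] := GP _ hQ.
have lim x : O x -> forall (f : nat -> K) l, vlim v f l ->
    vlim v (fun k => x * f k) (x * l).
  move=> Ox f l fl k; rewrite -mulrBr -[X in wge v X _]add0r.
  exact: wgeM.
have [zPQ _ _] := hPQ; have [zP _ _] := hP; have [zQ _ _] := hQ.
have l1 := lim _ zPQ _ _ gG; have l2 := lim _ zP _ _ gPG; have l3 := lim _ zQ _ _ gQG.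
apply: (vlim_unique l1) => k; have [gPE1 gPO] := gPE k; have [gQE1 gQO] := gQE k.
have [gE1 _] := gE k.
have [r r6] := add_z ha (inU_ppow k hP) (inU_ppow k hQ).
rewrite -ppow_add // gE1 gPE1 gQE1 => eq.
have pk0 : p%:R ^+ k != 0 :> K by rewrite expf_neq0.
have {}eq : (add P Q).1 * g k = P.1 * gP k + Q.1 * gQ k
    + r * p%:R ^+ k * (P.1 * gP k) * (Q.1 * gQ k).
  by apply: (mulfI pk0); rewrite eq; ring.
rewrite eq (_ : _ - _ = (P.1 * gP k - P.1 * G P) + (Q.1 * gQ k - Q.1 * G Q)
    + r * p%:R ^+ k * (P.1 * gP k) * (Q.1 * gQ k)); last by ring.
apply: wgeD; first by apply: wgeD; [apply: l2 | apply: l3].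
apply: wge_le (wgeM (wgeM (wgeM r6 (wge_exp_prime k)) (wgeM zP gPO)) (wgeM zQ gQO)).
by have := leq_pmull k e0; lia.
Qed.

Lemma wge6_0 (x : K) : wge v 6 x -> O x.
Proof. exact: wge_le. Qed.

Lemma vunit_1D6 (x : K) : wge v 6 x -> vunit v (1 + x).
Proof. by move=> h; apply: vunit_1D; apply: wge_le h. Qed.

Lemma vunit_1DV r : wge v 6 r -> wge v 6 ((1 + r)^-1 - 1).
Proof.
move=> r6; have u := vunit_1D6 r6.
have -> : (1 + r)^-1 - 1 = - r * (1 + r)^-1 by field; rewrite (vunit_neq0 u).
have := wgeM (wgeN r6) (vunit_wge (vunitV u)); by rewrite addr0.
Qed.

Lemma exp_exists : exists E : K -> K * K,
  [/\ forall a, O a -> inU (E a),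
      forall P, inU P -> exists2 a, O a & E a = P,
      forall a b, O a -> O b -> E (a + b) = add (E a) (E b) &
      forall a b, O a -> O b ->
        exists2 r, wge v 6 r & (E a).1 - (E b).1 = (a - b) * (1 + r)].
Proof.
have [L [LP Ladd]] := log_exists.
have LO P : inU P -> O (L P).
  move=> hP; have [r r6 ->] := LP P hP; have [h _ _] := hP.
  have := wgeM h (wgeD (wge_nat v 1) (wge6_0 r6)); by rewrite addr0.
(* L P - L Q = L (P - Q) by additivity, and translating P - Q and the origin by Q shows that z(P -
   Q) is z(P) - z(Q) up to a 1-unit. *)
have Lsub P Q : inU P -> inU Q ->
    exists2 r, wge v 6 r & L P - L Q = (P.1 - Q.1) * (1 + r).
  move=> hP hQ; have hN := inU_neg ha hQ; have hD := inU_add ha hP hN.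
  have PE : P = add (add P (neg Q)) Q.
    rewrite (add_assoc ha complete) // (inU_addC ha hN hQ) (cadd_neg ha) //.
    by rewrite (cadd_0r ha).
  have [r r6 rE] := LP _ hD.
  have [s s6] := add_z_sub ha (inU0 v W) hD hQ.
  rewrite -PE (cadd_0l ha) // subr0 => sE.
  have us := vunit_neq0 (vunit_1D6 s6).
  have tE := vunit_1DV s6; set t := _ - 1 in tE.
  have -> : L P - L Q = (P.1 - Q.1) * ((1 + r) * (1 + t)).
    rewrite {1}PE Ladd // rE addrK sE /t; field.
    by [].
  exists (r + t + r * t); last by ring.
  by apply: wgeD; [apply: wgeD | apply: wge_le (wgeM r6 tE)].
have Linj P Q : inU P -> inU Q -> L P = L Q -> P = Q.
  move=> hP hQ h; apply: (inU_inj ha) => //.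
  have [r r6] := Lsub _ _ hP hQ; rewrite h subrr => /esym/eqP.
  rewrite mulf_eq0 subr_eq0 => /orP[/eqP//|].
  by rewrite (negPf (vunit_neq0 (vunit_1D6 r6))).
have /choice[lift liftP] z : exists P, O z -> inU P /\ P.1 = z.
  have [h|h] := pselect (O z); last by exists (0, 0) => /h.
  by have [P hP Pz] := inU_lift ha complete h; exists P.
have Lsurj a : O a -> exists2 P, inU P & L P = a.
  move=> Oa; have [z Oz|x y Ox Oy|z Oz zE] :=
    @vcomplete_fixpoint K v (fun z => z + a - L (lift z)) complete.
  - have [h _] := liftP _ Oz; apply: wgeB; first exact: wgeD.
    exact: LO.
  - have [hx ex] := liftP _ Ox; have [hy ey] := liftP _ Oy.
    have [r r6] := Lsub _ _ hx hy; rewrite ex ey => h.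
    exists (- r); first exact: wgeN.
    transitivity ((x - y) - (L (lift x) - L (lift y))); first by ring.
    by rewrite h; ring.
  - have [h _] := liftP _ Oz; exists (lift z) => //.
    by apply/eqP; rewrite eq_sym -subr_eq0; apply/eqP/(addrI z); rewrite addr0 addrA.
have /choice[E EP] a : exists P, O a -> inU P /\ L P = a.
  have [h|h] := pselect (O a); last by exists (0, 0) => /h.
  by have [P hP Pa] := Lsurj _ h; exists P.
exists E; split.
- by move=> a /EP[].
- move=> P hP; exists (L P); first exact: LO.
  by have [h1 h2] := EP _ (LO _ hP); apply: Linj.
- move=> a b Oa Ob; have [ha1 ha2] := EP _ Oa; have [hb1 hb2] := EP _ Ob.
  have [hc1 hc2] := EP _ (wgeD Oa Ob).
  apply: Linj => //; first exact: (inU_add ha).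
  by rewrite hc2 Ladd // ha2 hb2.
- move=> a b Oa Ob; have [ha1 ha2] := EP _ Oa; have [hb1 hb2] := EP _ Ob.
  have [r r6] := Lsub _ _ ha1 hb1; rewrite ha2 hb2 => h.
  exists ((1 + r)^-1 - 1); first exact: vunit_1DV.
  rewrite h [1 + (_ - 1)]addrC subrK mulfK //.
  exact: (vunit_neq0 (vunit_1D6 r6)).
Qed.

End Logarithm.

(** * Points with non-singular reduction *)

Section E0Chart.
Variables (p : nat) (hp : prime p) (K : fieldExtType (padic hp)).
Variables (v : dvaluation K) (W : weierstrass K).
Hypotheses (v0 : forall x, intring x <-> wge v 0 x)
  (v6 : forall x, maxid x <-> wge v 6 x).
Hypothesis ha : [/\ wge v 6 (a1 W), wge v 6 (a2 W), wge v 6 (a3 W),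
  wge v 6 (a4 W) & wge v 6 (a6 W)].

(** The triple (z, -1, w) gives primitive homogeneous coordinates for all of [inU], the point at
    infinity included. *)
Lemma hcoord_chart P : inU v W P -> exists2 k : K, k != 0 &
  hcoord (chart P) = (k * P.1, k * -1, k * P.2).
Proof.
move=> hP; rewrite /chart; case: eqVneq => [w0|w0].
  exists (-1); first by rewrite oppr_eq0 oner_neq0.
  by rewrite (inU_w0 hP w0) /= !mulr0 mulrNN mulr1.
exists P.2^-1; first by rewrite invr_eq0.
by rewrite /= mulrN1 mulVf // mulrC.
Qed.

Lemma wge_cube (x : K) : wge v 6 (x ^+ 3) -> wge v 6 x.
Proof.
rewrite /wge expf_eq0 /=; case: eqVneq => //= x0.
by rewrite !exprS expr0 mulr1 !dvalM ?mulf_neq0 //; move: (v x) => a; lia.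
Qed.

Lemma wge_vunit (x : K) : wge v 0 x -> ~ wge v 6 x -> vunit v x.
Proof.
move=> h /negP; move: h; rewrite /wge /vunit; case: eqVneq => //= _.
by move: (v x) => a; lia.
Qed.

(** If Y were in m_K, the equation would put X^3, hence X, in m_K. This is the cusp of the reduced
    curve Y^2 Z = X^3, where all three partial derivatives vanish. *)
Lemma homogeneous_Y (X Y Z : K) : wge v 0 X -> wge v 0 Y -> wge v 0 Z ->
  Y ^+ 2 * Z + a1 W * X * Y * Z + a3 W * Y * Z ^+ 2 =
    X ^+ 3 + a2 W * X ^+ 2 * Z + a4 W * X * Z ^+ 2 + a6 W * Z ^+ 3 ->
  ~ [/\ maxid (dX W X Y Z), maxid (dY W X Y Z) & maxid (dZ W X Y Z)] ->
  ~ wge v 6 Y.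
Proof.
have [A1 A2 A3 A4 A6] := ha; have O2 := wge_nat v 2; have O3 := wge_nat v 3.
move=> hX hY hZ cE ns h; apply: ns.
have h' : wge v 6 X.
  apply: wge_cube.
  have -> : X ^+ 3 = Y ^+ 2 * Z + a1 W * X * Y * Z + a3 W * Y * Z ^+ 2
    - (a2 W * X ^+ 2 * Z + a4 W * X * Z ^+ 2 + a6 W * Z ^+ 3).
    by rewrite cE; ring.
  wge_sum.
by split; apply/v6; rewrite /dX /dY /dZ; wge_sum.
Qed.

Lemma E0_chart P : E0 W P <-> exists2 Q, inU v W Q & chart Q = P.
Proof.
have [A1 A2 A3 A4 A6] := ha.
have O1 := wge_nat v 1; have O2 := wge_nat v 2; have O3 := wge_nat v 3.
split=> [[cP nsP]|[Q hQ <-]]; last first.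
  split; first by case: hQ => _ _; apply: chart_on_curve.
  rewrite /nonsingular_reduction; have [k k0 ->] := hcoord_chart hQ.
  exists k^-1; rewrite /= !mulKf //; case: hQ => hz hw _.
  have ON1 : wge v 0 (-1) by apply: wgeN.
  have N1 : ~ maxid (-1 : K).
    by move/v6; rewrite /wge oppr_eq0 oner_eq0 dvalN dval1.
  split; [by split; apply/v0 | by case | case=> _ _ /v6 h].
  apply: N1; apply/v6.
  (* The definition of [dZ] solved for - Y^2, its only term without an a_i: if [dZ] were in m_K, so
     would be -1. *)
  have -> : -1 = a1 W * Q.1 * -1 + 2%:R * a3 W * -1 * Q.2 - a2 W * Q.1 ^+ 2
      - 2%:R * a4 W * Q.1 * Q.2 - 3%:R * a6 W * Q.2 ^+ 2 - dZ W Q.1 (-1) Q.2.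
    by rewrite /dZ; ring.
  wge_sum.
case: P cP nsP => [|x y] cP nsP.
  by exists (0, 0); [apply: inU0 | rewrite /chart /= eqxx].
move: nsP => [c [[/v0 hX /v0 hY /v0 hZ] _ ns]].
set X := c * x in hX ns; set Y := c * y in hY ns; set Z := c * 1 in hZ ns.
have cE : Y ^+ 2 * Z + a1 W * X * Y * Z + a3 W * Y * Z ^+ 2 =
    X ^+ 3 + a2 W * X ^+ 2 * Z + a4 W * X * Z ^+ 2 + a6 W * Z ^+ 3.
  transitivity (c ^+ 3 * (y ^+ 2 + a1 W * x * y + a3 W * y)).
    by rewrite /X /Y /Z; ring.
  by move: cP => /= ->; rewrite /X /Y /Z; ring.
have nY := homogeneous_Y hX hY hZ cE ns.
have uY := wge_vunit hY nY; have Y0 := vunit_neq0 uY.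
have [c0 y0] : c != 0 /\ y != 0 by move: Y0; rewrite mulf_eq0 negb_or => /andP.
have OY := vunit_wge (vunitV uY).
exists (- (X / Y), - (Z / Y)).
  have hXY : wge v 0 (- (X / Y)) := wgeN (wgeM hX OY).
  have hZY : wge v 0 (- (Z / Y)) := wgeN (wgeM hZ OY).
  split=> //=.
  transitivity ((Y ^+ 2 * Z + a1 W * X * Y * Z + a3 W * Y * Z ^+ 2 -
    (X ^+ 3 + a2 W * X ^+ 2 * Z + a4 W * X * Z ^+ 2 + a6 W * Z ^+ 3)) / Y ^+ 3).
    by rewrite /chart_eq; field.
  by rewrite cE subrr mul0r.
rewrite /chart /= oppr_eq0 mulf_eq0 invr_eq0 (negPf Y0) /Z mulr1 (negPf c0) /=.
rewrite invrN opprK mulrNN; congr Affine.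
  by rewrite invf_div mulrA divfK // /X mulrAC divff ?mul1r.
by rewrite invf_div /Y mulrAC divff ?mul1r.
Qed.

End E0Chart.

(** * Compatibility of the parametrization with the group law and with p-adic scaling *)

Section Parametrization.
Variables (p : nat) (hp : prime p) (K : fieldExtType (padic hp)).
Variables (v : dvaluation K) (W : weierstrass K).
Hypotheses (v0 : forall x, intring x <-> wge v 0 x)
  (v6 : forall x, maxid x <-> wge v 6 x).
Hypothesis ha : [/\ wge v 6 (a1 W), wge v 6 (a2 W), wge v 6 (a3 W),
  wge v 6 (a4 W) & wge v 6 (a6 W)].
Local Notation Zp := (padic_int hp).
Local Notation iota := (padic_int_emb K).
Local Notation O := (wge v 0).
Local Notation inU := (inU v W).
Local Notation add := (cadd W).
Variable E : K -> K * K.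
Hypotheses (EU : forall a, O a -> inU (E a))
  (ED : forall a b, O a -> O b -> E (a + b) = add (E a) (E b))
  (Elip : forall a b, O a -> O b ->
    exists2 r, wge v 6 r & (E a).1 - (E b).1 = (a - b) * (1 + r)).
Variables (n : nat) (X : 'I_n -> K).
Hypothesis OX : forall i, intring (X i).
Local Notation f u := (chart (E (comb X u))).

Let Oc u : O (comb X u).
Proof. by apply/v0/comb_intring. Qed.

Lemma exp0 : E 0 = (0, 0).
Proof.
have O0 := wge0x v 0; have h := EU O0.
apply: (inU_inj ha h (inU0 v W)); apply: (add_injl ha h (inU0 v W) h).
by rewrite -ED // addr0 (cadd_0l ha).
Qed.

Lemma expN a : O a -> E (- a) = cneg W (E a).
Proof.
move=> Oa; have hN := EU (wgeN Oa); have h := inU_neg ha (EU Oa).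
apply: (inU_inj ha hN h); apply: (add_injl ha hN h (EU Oa)).
rewrite -ED ?wgeN // addNr exp0 (inU_addC ha h (EU Oa)).
by rewrite (cadd_neg ha) //; apply: EU.
Qed.

Lemma param_add u w : f (u + w) = pt_add W (f u) (f w).
Proof. by rewrite combD ED // (chart_add ha) //; apply: EU. Qed.

Lemma param0 : f 0 = Infinity.
Proof.
by rewrite -(subrr (0 : 'rV[Zp]_n)) combB subrr exp0 /chart /= eqxx.
Qed.

Lemma paramN u : f (- u) = pt_opp W (f u).
Proof.
rewrite -[- u]sub0r combB -(subrr (0 : 'rV[Zp]_n)) combB subrr sub0r expN //.
by rewrite chart_neg // (inU_nden ha) //; apply: EU.
Qed.

Lemma param_muln k u : pt_muln W k (f u) = f (u *+ k).
Proof.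
elim: k => [|k IH]; first by rewrite mulr0n param0.
by rewrite /pt_muln iterS -/(pt_muln W k (f u)) IH mulrS param_add.
Qed.

Lemma param_mulz m u : pt_mulz W m (f u) = f (u *~ m).
Proof.
case: m => k; first exact: param_muln.
by rewrite NegzE mulrNz paramN /= -param_muln.
Qed.

Lemma param_scale a u : is_padic_scale W a (f u) (f (a *: u)).
Proof.
move=> m ma.
have /choice[k kP] j : exists k : K, k != 0 /\
    hcoord (pt_mulz W (m j) (f u)) =
    (k * (E (comb X (u *~ m j))).1, k * -1, k * (E (comb X (u *~ m j))).2).
  rewrite param_mulz.
  by have [k k0 ->] := hcoord_chart (EU (Oc (u *~ m j))); exists k.
have hQ := EU (Oc (a *: u)); have [q q0 qE] := hcoord_chart hQ.
(* This rescales the coordinates of each multiple from k_j (z, -1, w) to q (z, -1, w), with the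
   factor q of the limit point. *)
exists (fun j => q / k j).
  by move=> j; have [k0 _] := kP j; rewrite mulf_neq0 ?invr_neq0.
rewrite qE.
have cancel j x : q / k j * (k j * x) = q * x.
  by have [k0 _] := kP j; rewrite -mulrA mulKf.
(* The factor q need not be integral, so M extra digits of precision are requested. *)
have [M OM] := intring_denominator q.
have key N : exists J, forall j, (J <= j)%N -> exists2 b, intring b &
    (E (comb X (u *~ m j))).1 - (E (comb X (a *: u))).1 = p%:R ^+ (N + M) * b.
  have [J JP] := ma (N + M)%N; exists J => j /JP[b _ bE].
  have [r r6 ->] := Elip (Oc (u *~ m j)) (Oc (a *: u)).
  have -> : u *~ m j = (m j)%:~R *: u by rewrite scaler_int.
  rewrite -combB -scalerBl bE combZ (rmorphM iota) (rmorphXn iota) (rmorph_nat iota).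
  exists (iota b * comb X u * (1 + r)); last by ring.
  apply/v0; rewrite -[0]addr0 -[X in wge v (X + _)]addr0; apply: wgeM.
    by apply: wgeM => //; apply/v0/intring_emb.
  by apply: wgeD (wge_nat v 1) (wge6_0 r6).
(* The three coordinates z, -1 and w are all Lipschitz functions of z, so one argument serves for
   them all. *)
have lim (g : K * K -> K) : (forall P Q, inU P -> inU Q ->
      exists2 l, O l & g P - g Q = l * (P.1 - Q.1)) ->
    padic_lim (@intring p hp K) p
      (fun j => q / k j * (k j * g (E (comb X (u *~ m j)))))
      (q * g (E (comb X (a *: u)))).
  move=> hg N; have [J JP] := key N; exists J => j /JP[b Ob bE].
  have [l Ol lE] := hg _ _ (EU (Oc (u *~ m j))) hQ.
  rewrite cancel -mulrBr lE bE exprD.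
  exists (p%:R ^+ M * q * l * b); last by ring.
  by do !apply: intringM => //; apply/v0.
split.
- have -> : (fun j => q / k j * (hcoord (pt_mulz W (m j) (f u))).1.1)
      = (fun j => q / k j * (k j * (E (comb X (u *~ m j))).1)).
    by apply/funext => j; have [_ ->] := kP j.
  by apply: (lim fst) => P Q _ _; exists 1; rewrite ?mul1r //; apply: wge_nat 1.
- have -> : (fun j => q / k j * (hcoord (pt_mulz W (m j) (f u))).1.2)
      = (fun j => q / k j * (k j * -1)).
    by apply/funext => j; have [_ ->] := kP j.
  apply: (lim (fun=> -1)) => P Q _ _; exists 0; rewrite ?mul0r ?subrr //.
  exact: wge0x.
- have -> : (fun j => q / k j * (hcoord (pt_mulz W (m j) (f u))).2)
      = (fun j => q / k j * (k j * (E (comb X (u *~ m j))).2)).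
    by apply/funext => j; have [_ ->] := kP j.
  apply: (lim snd) => P Q hP hQ'; exact: (inU_w_sub ha hQ' hP).
Qed.

End Parametrization.

Theorem theorem3 (p : nat) (hp : prime p) (K : fieldExtType (padic hp))
    (n e : nat) (hn : \dim {:K} = n) (he : ramification_index K e)
    (W : weierstrass K) (hW : elliptic W)
    (ha : [/\ maxid (a1 W), maxid (a2 W), maxid (a3 W), maxid (a4 W)
            & maxid (a6 W)])
    (hpe : (6 * e < p - 1)%N) :
  exists f : 'rV[padic_int hp]_n -> point K,
    [/\ injective f,
        forall P : point K, E0 W P <-> exists u, f u = P,
        forall u v, f (u + v) = pt_add W (f u) (f v)
      & forall (a : padic_int hp) u, is_padic_scale W a (f u) (f (a *: u))].
Proof.
have [v [v0 v6 vp e0]] := ramification_valuation he.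
have {}ha : [/\ wge v 6 (a1 W), wge v 6 (a2 W), wge v 6 (a3 W),
  wge v 6 (a4 W) & wge v 6 (a6 W)] by case: ha; split; apply/v6.
have complete := intring_complete v0 vp e0.
have [X [OX injX surjX]] := integer_basis (intring_separated v0 vp e0).
rewrite {}hn in X OX injX surjX.
have [E [EU Esurj ED Elip]] := exp_exists ha complete hp (p_neq0 K) vp e0 hpe.
have Oc u : wge v 0 (comb X u) by apply/v0/comb_intring.
exists (fun u => chart (E (comb X u))); split.
- move=> u w /(chart_inU_inj (EU _ (Oc u)) (EU _ (Oc w))) eE; apply: injX.
  have [r r6] := Elip _ _ (Oc u) (Oc w); rewrite eE subrr => /esym/eqP.
  rewrite mulf_eq0 subr_eq0 (negPf (vunit_neq0 (vunit_1D6 r6))) orbF.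
  by move/eqP.
- move=> P; rewrite (E0_chart v0 v6 ha); split=> [[Q hQ <-]|[u <-]].
    have [a Oa <-] := Esurj _ hQ; have [|u <-] := surjX a; first exact/v0.
    by exists u.
  by exists (E (comb X u)) => //; apply: EU.
- exact: (param_add v0 ha EU ED OX).
- exact: (param_scale v0 ha EU ED Elip OX).
Qed.
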